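(* Let $\mathbb{k}$ be an arbitrary field, $R=\mathbb{k}[x_1,\ldots,x_d]$ a polynomial ring with the standard grading, and let $\underline{\nu}=\nu_1,\ldots,\nu_r$ be normalized monomial valuations on $R$. For each integer $n\geq 0$ let $$I_n(\underline{\nu})=\{f\in R \mid \nu_i(f)\geq n \text{ for all } 1\leq i\leq r\}.$$ Then: (1) $\operatorname{depth}(I_n(\underline{\nu}))\leq \operatorname{depth}\big(I_{\lceil n/m\rceil}(\underline{\nu})\big)$ for all integers $n,m>0$. (2) The limit $\lim_{n\to\infty}\operatorname{depth}(R/I_n(\underline{\nu}))$ exists and is equal to $\min_{n\geq 1}\{\operatorname{depth}(R/I_n(\underline{\nu}))\}$. In particular, (1) and (2) hold for the filtration $\{I^{(n)}\}_{n\geq 0}$ of symbolic powers of a squarefree monomial ideal $I\subseteq R$, and for the filtration $\{\overline{J^{n/e}}\}_{n\geq 0}$ of rational powers of a monomial ideal $J\subseteq R$, where $e$ is the least common multiple of the values on $J$ of the Rees valuations of $J$.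
   Context: A monomial valuation on $R$ is a valuation $\nu:R\setminus\{0\}\to\mathbb{R}_{\geq 0}$ (so $\nu(fg)=\nu(f)+\nu(g)$ and $\nu(f+g)\geq\min\{\nu(f),\nu(g)\}$) such that $\nu(\sum_\alpha\lambda_\alpha x^\alpha)=\min\{\nu(x^\alpha)\mid\lambda_\alpha\neq 0\}$; it is determined by a vector $w$ with $\nu(x^\alpha)=w\cdot\alpha$. It is normalized if $w\in\mathbb{Z}_{\geq 0}^d$. Convention: $\nu(0)=\infty$. The ideals $I_n(\underline{\nu})$ are monomial. Depth is taken with respect to the homogeneous maximal ideal $\mathfrak{m}=(x_1,\ldots,x_d)$. For a radical ideal $I$, the $n$-th symbolic power is $I^{(n)}=\bigcap_{\mathfrak p}(I^nR_{\mathfrak p}\cap R)$, over the minimal primes $\mathfrak p$ of $I$. If $I=Q_1\cap\cdots\cap Q_r$ is the prime decomposition of a squarefree monomial ideal, then $I^{(n)}=I_n(\underline\nu)$ for $\nu_i(f)=\max\{n\mid f\in Q_i^n\}$. For a nonzero proper ideal $J$ and a rational number $p/q\geq 0$ ($p\ge 0$, $q>0$ integers), the rational power is $\overline{J^{p/q}}=\{f\in R\mid f^q\in\overline{J^p}\}$, where the overline on the right denotes integral closure. If $J$ is monomial with Rees valuations $v_1,\ldots,v_r$ (which are monomial, taken integer valued), $v_i(J)=\min\{v_i(f)\mid f\in J\}$ and $e=\operatorname{lcm}(v_1(J),\ldots,v_r(J))$, then $\overline{J^{n/e}}=I_n(\underline\nu)$ for $\nu_i=\frac{e}{v_i(J)}v_i$.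 *)

(* Defs.v *)
From HB Require Import structures.
From mathcomp Require Import all_boot all_order all_algebra.
From mathcomp Require Import generic_quotient ring_quotient.
From mathcomp Require Import mpoly.
From mathcomp Require Import boolp classical_sets reals constructive_ereal.

Set Implicit Arguments.
Unset Strict Implicit.
Unset Printing Implicit Defensive.

Import Order.TTheory GRing.Theory Num.Theory.

Local Open Scope classical_set_scope.
Local Open Scope quotient_scope.
Local Open Scope ring_scope.

Definition is_ideal (R : comNzRingType) (I : set R) : Prop :=
  [/\ I 0, (forall x y, I x -> I y -> I (x + y))
     & (forall a x, I x -> I (a * x))].

Record ideal (R : comNzRingType) := Ideal {
  ideal_set :> set R;
  idealP : is_ideal ideal_set }.

Section IdealModules.
Variables (R : comNzRingType) (I : ideal R).

Definition ideal_pred : {pred R^o} := fun x => `[< ideal_set I x >].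

Lemma ideal_pred_submod : submod_closed ideal_pred.
Proof.
have [I0 ID IM] := idealP I; split; first exact/asboolP.
by move=> a x y /asboolP Ix /asboolP Iy; apply/asboolP/ID => //; exact: IM.
Qed.

HB.instance Definition _ :=
  GRing.isSubmodClosed.Build R R^o ideal_pred ideal_pred_submod.

Record ideal_mod := IdealMod {
  ideal_mod_val : R^o;
  _ : ideal_mod_val \in ideal_pred }.

HB.instance Definition _ := [isSub for ideal_mod_val].
HB.instance Definition _ := [Choice of ideal_mod by <:].
HB.instance Definition _ := [SubChoice_isSubLmodule of ideal_mod by <:].

(* R/I as an R-module; MathComp's {ideal_quot _} is a nontrivial ring and so
   excludes I = R, hence we start from the quotient of additive groups. *)
Definition quot_mod : Type := @Quotient.quot R^o ideal_pred.

HB.instance Definition _ := GRing.Zmodule.on quot_mod.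
HB.instance Definition _ := EqQuotient.on quot_mod.

Lemma quot_mod_piD (x y : R^o) :
  \pi_quot_mod (x + y) = \pi_quot_mod x + \pi_quot_mod y :> quot_mod.
Proof. exact: Quotient.pi_add. Qed.

Definition quot_mod_scale (a : R) (x : quot_mod) : quot_mod :=
  \pi_quot_mod (a *: (repr x : R^o)).

Lemma quot_mod_scale_pi a (x : R^o) :
  quot_mod_scale a (\pi_quot_mod x) = \pi_quot_mod (a *: x).
Proof.
apply/eqP; rewrite /quot_mod_scale -Quotient.idealrBE -scalerBr.
apply: rpredZ; rewrite Quotient.idealrBE; apply/eqP; exact: reprK.
Qed.

Lemma quot_mod_scaleA a b x :
  quot_mod_scale a (quot_mod_scale b x) = quot_mod_scale (a * b) x.
Proof.
elim/quotW: x => x; rewrite [quot_mod_scale b _]quot_mod_scale_pi.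
by rewrite !quot_mod_scale_pi scalerA.
Qed.

Lemma quot_mod_scale1 : left_id 1 quot_mod_scale.
Proof. by elim/quotW => x; rewrite quot_mod_scale_pi scale1r. Qed.

Lemma quot_mod_scaleDr : right_distributive quot_mod_scale +%R.
Proof.
move=> a; elim/quotW => x; elim/quotW => y.
by rewrite -quot_mod_piD !quot_mod_scale_pi scalerDr quot_mod_piD.
Qed.

Lemma quot_mod_scaleDl x : {morph quot_mod_scale^~ x : a b / a + b}.
Proof.
move=> a b; elim/quotW: x => x.
by rewrite !quot_mod_scale_pi scalerDl quot_mod_piD.
Qed.

HB.instance Definition _ := GRing.Zmodule_isLmodule.Build R quot_mod
  quot_mod_scaleA quot_mod_scale1 quot_mod_scaleDr quot_mod_scaleDl.

End IdealModules.

Inductive enat := Fin of nat | Inf.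

Definition le_enat (a b : enat) : Prop :=
  match a, b with
  | _, Inf => True
  | Inf, Fin _ => False
  | Fin p, Fin q => (p <= q)%N
  end.

Section Depth.
Variables (R : comNzRingType) (M : lmodType R).

(* The submodule (s_1, ..., s_n)M. *)
Definition seq_smul (s : seq R) : set M :=
  [set x | exists y : 'I_(size s) -> M, x = \sum_(i < size s) s`_i *: y i].

(* The submodule mM. *)
Definition ideal_smul (m : set R) : set M :=
  [set x | exists s : seq R, (forall a, a \in s -> m a) /\ seq_smul s x].

Definition regular_seq (s : seq R) : Prop :=
  (forall i : nat, (i < size s)%N -> forall x : M,
     seq_smul (take i s) (s`_i *: x) -> seq_smul (take i s) x)
  /\ seq_smul s <> setT.

Definition regular_lengths (m : set R) : set nat :=
  [set size s | s in [set s | regular_seq s /\ forall a, a \in s -> m a]].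

(* The supremum of the lengths of the M-regular sequences in m, with the usual
   convention that the depth is infinite when mM = M, in particular for M = 0.
   When mM <> M the set of lengths contains 0. *)
Definition depth (m : set R) : enat :=
  if pselect (ideal_smul m = setT) then Inf
  else match pselect (exists n, regular_lengths m n /\
                        forall l, regular_lengths m l -> (l <= n)%N) with
       | left ex_max => Fin (sval (cid ex_max))
       | right _ => Inf
       end.

End Depth.

Section IdealOperations.
Variable R : comNzRingType.
Implicit Types (I : ideal R) (p : ideal R).

Lemma smallest_ideal_is_ideal (S : set R) : is_ideal (smallest (@is_ideal R) S).
Proof.
split; first by move=> J [[]].
- move=> x y Sx Sy J SJ; have [[_ JD _] _] := SJ.
  by apply: JD; [exact: Sx | exact: Sy].
- by move=> a x Sx J SJ; have [[_ _ JM] _] := SJ; apply: JM; exact: Sx.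
Qed.

Definition ideal_gen (S : set R) : ideal R := Ideal (smallest_ideal_is_ideal S).

Definition ideal_pow I (n : nat) : ideal R :=
  ideal_gen [set \prod_(i < n) g i | g in [set g : 'I_n -> R | forall i, ideal_set I (g i)]].

Definition integral_closure I : set R :=
  [set f | exists n : nat, exists a : nat -> R,
     [/\ (0 < n)%N,
         (forall i, (1 <= i <= n)%N -> ideal_set (ideal_pow I i) (a i))
       & f ^+ n + \sum_(1 <= i < n.+1) a i * f ^+ (n - i) = 0]].

(* The rational power of exponent a/b. *)
Definition rational_power I (a b : nat) : set R :=
  [set f | integral_closure (ideal_pow I a) (f ^+ b)].

Definition prime_ideal p : Prop :=
  ~ ideal_set p 1 /\
  forall x y, ideal_set p (x * y) -> ideal_set p x \/ ideal_set p y.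

Definition minimal_prime I p : Prop :=
  [/\ prime_ideal p, I `<=` p
    & forall q : ideal R, prime_ideal q -> I `<=` q -> q `<=` p -> p `<=` q].

(* For a domain R, I^n R_p \cap R = {f | s f \in I^n for some s \notin p}. *)
Definition symbolic_power_set I (n : nat) : set R :=
  [set f | forall p, minimal_prime I p ->
     exists2 s, ~ ideal_set p s & ideal_set (ideal_pow I n) (s * f)].

Lemma symbolic_power_is_ideal I n : is_ideal (symbolic_power_set I n).
Proof.
have [P0 PD PM] := idealP (ideal_pow I n).
split.
- by move=> p [[p1 _] _ _]; exists 1 => //; rewrite mulr0.
- move=> f g If Ig p mp; have [[_ pM] _ _] := mp.
  have [s ps sf] := If p mp; have [t pt tg] := Ig p mp.
  exists (s * t); first by move=> /pM[].
  rewrite mulrDr; apply: PD; last by rewrite -mulrA; apply: PM.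
  by rewrite [s * t]mulrC -mulrA; apply: PM.
- move=> a f If p mp; have [s ps sf] := If p mp.
  by exists s => //; rewrite mulrCA; apply: PM.
Qed.

Definition symbolic_power I n : ideal R := Ideal (symbolic_power_is_ideal I n).

End IdealOperations.

Section Valuations.
Variables (R : comNzRingType) (K : realType).
Local Open Scope ereal_scope.

Definition is_valuation (v : R -> \bar K) : Prop :=
  [/\ v 0%R = +oo,
      (forall f, f != 0%R -> exists2 x : K, (0 <= x)%R & v f = x%:E),
      (forall f g, v (f * g)%R = v f + v g)
    & (forall f g, Order.min (v f) (v g) <= v (f + g)%R)].

Record valuation := Valuation {
  valuation_fun :> R -> \bar K;
  valuationP : is_valuation valuation_fun }.

Lemma valuation_ge0 (v : valuation) f : 0 <= v f.
Proof.
have [v0 vpos _ _] := valuationP v.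
have [->|/vpos[x x0 ->]] := eqVneq f 0%R; first by rewrite v0 leey.
by rewrite lee_fin.
Qed.

Definition val_ideal_set r (nu : 'I_r -> valuation) (n : nat) : set R :=
  [set f | forall i, n%:R%:E <= nu i f].

Lemma val_ideal_is_ideal r (nu : 'I_r -> valuation) n :
  is_ideal (val_ideal_set nu n).
Proof.
split.
- by move=> i; have [-> _ _ _] := valuationP (nu i); rewrite leey.
- move=> f g nf ng i; have [_ _ _ nuD] := valuationP (nu i).
  by apply: le_trans (nuD f g); rewrite le_min nf ng.
- move=> a f nf i; have [_ _ -> _] := valuationP (nu i).
  by apply: le_trans (nf i) _; rewrite leeDr// valuation_ge0.
Qed.

Definition val_ideal r (nu : 'I_r -> valuation) n : ideal R :=
  Ideal (val_ideal_is_ideal nu n).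

Definition integer_valued (v : valuation) : Prop :=
  forall f, f != 0%R -> exists n : nat, v f = n%:R%:E.

(* v(J) = c, where v(J) is the minimum of v on J. *)
Definition value_on_ideal (v : valuation) (J : ideal R) (c : nat) : Prop :=
  (exists2 f, ideal_set J f & v f = c%:R%:E) /\
  (forall f, ideal_set J f -> c%:R%:E <= v f).

Definition determines_closures (J : ideal R) r (v : 'I_r -> valuation)
    (c : 'I_r -> nat) (A : {set 'I_r}) : Prop :=
  forall n f, integral_closure (ideal_pow J n) f <->
    forall i, i \in A -> (n * c i)%:R%:E <= v i f.

(* v_1, ..., v_r are the Rees valuations of J, with v_i(J) = c_i: a minimal set
   of discrete valuations, nonnegative on R, that determines the integral
   closures of all powers of J.  It is unique up to order and equivalence.  No
   integer scaling of the v_i is imposed; normalizing the value groups to be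
   all of Z is a special case. *)
Definition rees_valuations (J : ideal R) r (v : 'I_r -> valuation)
    (c : 'I_r -> nat) : Prop :=
  [/\ forall i, integer_valued (v i),
      forall i, value_on_ideal (v i) J (c i),
      determines_closures J v c [set: 'I_r]%SET
    & forall A : {set 'I_r}, A \proper [set: 'I_r]%SET ->
        ~ determines_closures J v c A].

End Valuations.

Section Polynomials.
Variables (k : fieldType) (d : nat).
Local Notation R := {mpoly k[d]}.

Definition max_ideal : ideal R := ideal_gen [set 'X_i | i in [set: 'I_d]].

Definition monomial_ideal (J : ideal R) : Prop :=
  exists A : set 'X_{1..d},
    J = ideal_gen [set ('X_[a] : R) | a in A] :> set R.

Definition squarefree_monomial_ideal (I : ideal R) : Prop :=
  exists2 A : set 'X_{1..d}, (forall a i, A a -> (a i <= 1)%N)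
    & I = ideal_gen [set ('X_[a] : R) | a in A] :> set R.

Definition monomial_valuation (K : realType) (v : valuation R K) : Prop :=
  forall f : R, v f = \big[Order.min/+oo%E]_(a <- msupp f) v 'X_[a].

(* For a monomial valuation: its vector w lies in Z_{>= 0}^d. *)
Definition normalized (K : realType) (v : valuation R K) : Prop :=
  exists w : 'I_d -> nat, forall a : 'X_{1..d},
    v 'X_[a] = ((\sum_(i < d) w i * a i)%N%:R)%:E.

Definition ceil_div (n m : nat) : nat := (n + m.-1) %/ m.

Definition depth_ideal (I : ideal R) : enat := depth (ideal_mod I) max_ideal.

Definition depth_quot (I : ideal R) : enat := depth (quot_mod I) max_ideal.

Definition depth_ceil_le (F : nat -> ideal R) : Prop :=
  forall n m, (0 < n)%N -> (0 < m)%N ->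
    le_enat (depth_ideal (F n)) (depth_ideal (F (ceil_div n m))).

(* A limit of numbers in the discrete set N u {oo} is an eventual value. *)
Definition depth_lim_eq_min (F : nat -> ideal R) : Prop :=
  exists l : enat,
    [/\ exists N, forall n, (N <= n)%N -> depth_quot (F n) = l,
        exists2 n, (1 <= n)%N & depth_quot (F n) = l
      & forall n, (1 <= n)%N -> le_enat l (depth_quot (F n))].

End Polynomials.

(* Main.v *)
Require Import Defs.
From HB Require Import structures.
From mathcomp Require Import all_boot all_order all_algebra.
From mathcomp Require Import mpoly.
From mathcomp Require Import boolp classical_sets reals constructive_ereal.

Set Implicit Arguments.
Unset Strict Implicit.
Unset Printing Implicit Defensive.

Import Order.TTheory GRing.Theory Num.Theory.

Local Open Scope classical_set_scope.
Local Open Scope ring_scope.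

(* Monomial valuations only see exponents: each of the three filtrations is of
   the form F_n = {f | w.a >= n for all exponents a of f and all w in W} for a
   set W of weight vectors in N^d.  Let phi : R -> R be x_i |-> x_i^m.  Since
   w.(m a) >= n iff w.a >= ceil(n/m), phi embeds F_ceil(n/m) in F_n, and killing
   the monomials that are not m-th powers splits it; likewise for the quotients.
   The depth of F_n can be computed by regular sequences in phi(max_ideal), and
   these descend to the direct summand, which gives (1) for F_n and for R/F_n.
   To move a regular sequence s_1, ..., s_t into phi(max_ideal), prime avoidance
   yields c in phi(max_ideal) regular modulo (s_1, ..., s_j) for every j < t;
   then s_1, ..., s_(t-1) is regular modulo c, and one recurses.
   For (2), if n0 minimizes the depth of R/F_n then every n >= n0^2 satisfies
   ceil(n/m) = n0 for some m, so that depth R/F_n <= depth R/F_n0. *)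

(** * Prime avoidance and regular sequences *)

Definition prime_set (R : comNzRingType) (p : set R) : Prop :=
  [/\ is_ideal p, ~ p 1 & forall x y, p (x * y) -> p x \/ p y].

Section PrimeAvoidance.
Variables (R : comNzRingType) (A : set R).
Hypothesis AD : forall x y, A x -> A y -> A (x + y).
Hypothesis AM : forall x y, A x -> A y -> A (x * y).

(** Start from an element of [A] outside p and multiply in, for each q, an element of [A] in q but
    not in p when there is one. Only sums and products stay in [A]: the intended [A] is phi(m), in
    general not an ideal of R. *)
Lemma prime_separation (p : set R) (qs : seq (set R)) :
    prime_set p -> ~ A `<=` p -> (forall q, q \in qs -> is_ideal q) ->
  exists c, [/\ A c, ~ p c
    & forall q, q \in qs -> q c \/ A `&` q `<=` p].
Proof.
move=> [_ _ pM] /existsNP[b /not_implyP[Ab pb]].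
elim: qs => [|q qs IHqs] qsI; first by exists b.
have [|c [Ac pc cqs]] := IHqs.
  by move=> q' q'qs; apply: qsI; rewrite inE q'qs orbT.
have [Aqp|/existsNP[u /not_implyP[[Au qu] pu]]] := pselect (A `&` q `<=` p).
  exists c; split=> // q'; rewrite inE => /orP[/eqP->|/cqs//].
  by right.
exists (c * u); split; [exact: AM | by move=> /pM[] |] => q'.
have idl q0 : q0 \in q :: qs -> q0 c \/ q0 u -> q0 (c * u).
  by move=> /qsI[_ _ q0M] [?|?]; [rewrite mulrC|]; apply: q0M.
move=> q'in; move: (q'in); rewrite inE => /orP[/eqP q'q|/cqs[q'c|]].
- by left; apply: idl => //; right; rewrite q'q.
- by left; apply: idl => //; left.
- by right.
Qed.

(** If a avoids ps but lies in the new prime p, add c outside p. For q in ps, a + c in q would force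
    a into q when q contains c, and a + c into p when [A] and q meet inside p. *)
Lemma prime_avoidance (ps : seq (set R)) :
    (exists a, A a) -> (forall p, p \in ps -> prime_set p /\ ~ A `<=` p) ->
  exists2 a, A a & forall p, p \in ps -> ~ p a.
Proof.
move=> A0; elim: ps => [|p ps IHps] psP; first by case: A0 => a Aa; exists a.
have [|a Aa aps] := IHps.
  by move=> q qps; apply: psP; rewrite inE qps orbT.
have [pP pA] : prime_set p /\ ~ A `<=` p by apply: psP; rewrite mem_head.
have [pa|npa] := pselect (p a); last first.
  by exists a => // q; rewrite inE => /orP[/eqP->|/aps].
have [|c [Ac pc cps]] := prime_separation (qs := ps) pP pA.
  by move=> q qps; have [|[]] := psP q; rewrite ?inE ?qps ?orbT.
have subid (q : set R) x y : is_ideal q -> q x -> q (x + y) -> q y.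
  move=> [_ qD qM] qx qxy; rewrite -[y](addKr x) -mulN1r.
  by apply: qD => //; apply: qM.
exists (a + c); first exact: AD.
have pac : ~ p (a + c).
  by move=> /(subid _ _ _ _ pa) pc'; apply/pc/pc'; case: pP.
move=> q; rewrite inE => /orP[/eqP->//|qps] qac.
have [qc|Aqp] := cps q qps; last by apply/pac/Aqp; split=> //; exact: AD.
have qI : is_ideal q by have [|[]] := psP q; rewrite ?inE ?qps ?orbT.
by apply: (aps q qps); apply: (subid _ _ _ qI qc); rewrite addrC.
Qed.

End PrimeAvoidance.

(** Otherwise choose an element of each [F i] outside p: the product lies in every [F i] but not in
    p. *)
Lemma prime_ideal_meet (R : comNzRingType) (p : set R) n (F : nat -> set R) :
    prime_set p -> (forall i, (i < n)%N -> is_ideal (F i)) ->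
    (forall x, (forall i, (i < n)%N -> F i x) -> p x) ->
  exists2 i, (i < n)%N & F i `<=` p.
Proof.
move=> [_ p1 pM] FI Fp; apply: contrapT => /forall2NP FNp.
suff [c pc cF] : exists2 c, ~ p c & forall i, (i < n)%N -> F i c.
  exact/pc/Fp.
elim: n FI {Fp} FNp => [|n IHn] FI FNp; first by exists 1.
have [||c pc cF] := IHn.
- by move=> i ltin; apply: FI; rewrite ltnW.
- by move=> i; have [nlt|] := FNp i; [left; apply: contra_not nlt => /ltnW|right].
have [/(_ (ltnSn n))//|/existsNP[u /not_implyP[Fu pu]]] := FNp n.
exists (c * u); first by move=> /pM[].
move=> i; rewrite ltnS leq_eqVlt => /orP[/eqP->|ltin].
  by have [_ _ FM] := FI n (ltnSn n); apply: FM.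
have [_ _ FM] := FI i (ltnW ltin); rewrite mulrC; apply: FM; exact: cF.
Qed.

(** A sequential form of the ascending chain condition, for the spans of the initial segments of
    p. *)
Definition noetherian (R : comNzRingType) (M : lmodType R) : Prop :=
  forall p : nat -> M, exists n (r : nat -> R), p n = \sum_(i < n) r i *: p i.

Section RegularSequences.
Variables (R : comNzRingType) (M : lmodType R).
Implicit Types (N : set M) (s : seq R) (A m : set R).

Definition is_submod N : Prop :=
  [/\ N 0, (forall x y, N x -> N y -> N (x + y))
     & (forall a x, N x -> N (a *: x))].

(** The annihilator of the class of x in M/N. Working relative to N avoids forming iterated quotient
    modules. *)
Definition ann N (x : M) : set R := [set r | N (r *: x)].

Definition max_ann N (x : M) : Prop :=
  ~ N x /\ forall y, ~ N y -> ann N x `<=` ann N y -> ann N y `<=` ann N x.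

Lemma submod_sum N n (F : nat -> M) :
  is_submod N -> (forall i, (i < n)%N -> N (F i)) -> N (\sum_(i < n) F i).
Proof.
move=> [N0 ND _] NF; apply: (big_ind N) => // i _; exact: NF.
Qed.

Lemma ann_ideal N x : is_submod N -> is_ideal (ann N x).
Proof.
move=> [N0 ND NM]; split; rewrite /ann /=; first by rewrite scale0r.
- by move=> a b Na Nb; rewrite scalerDl; apply: ND.
- by move=> a b Nb; rewrite -scalerA; apply: NM.
Qed.

(** If ab kills x modulo N and a does not, then b kills ax, whose annihilator contains that of x and
    so equals it. *)
Lemma max_ann_prime N x : is_submod N -> max_ann N x -> prime_set (ann N x).
Proof.
move=> sN [Nx xmax]; split; [exact: ann_ideal | by rewrite /ann /= scale1r |].
move=> a b Nab; have [Na|nNa] := pselect (ann N x a); [by left | right].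
apply: (xmax _ nNa); last by rewrite /ann /= scalerA mulrC.
by case: sN => _ _ NM r Nr; rewrite /ann /= scalerA mulrC -scalerA; apply: NM.
Qed.

(** Otherwise there is a strictly increasing chain of annihilators. Elements r_n new at each stage
    cannot be combinations of earlier ones, against noetherianity. *)
Lemma max_ann_exists N x : noetherian R^o -> is_submod N -> ~ N x ->
  exists2 y, max_ann N y & ann N x `<=` ann N y.
Proof.
move=> noeR sN Nx; apply: contrapT => /forall2NP nomax.
pose T := {y | ~ N y /\ ann N x `<=` ann N y}.
have step (y : T) : exists z : T,
    ann N (sval y) `<=` ann N (sval z)
    /\ exists r, ann N (sval z) r /\ ~ ann N (sval y) r.
  case: y => y [/= Ny xy]; have [|//] := nomax y.
  move=> /not_andP[//|/existsNP[z /not_implyP[Nz /not_implyP[yz]]]].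
  move=> /existsNP[r /not_implyP[zr yr]].
  by exists (exist _ z (conj Nz (subset_trans xy yz))); split=> //; exists r.
have [f fP] := choice step.
have x0 : T by exists x; split.
pose y n := iter n f x0.
have ymono i n : (i <= n)%N -> ann N (sval (y i)) `<=` ann N (sval (y n)).
  elim: n => [|n IHn]; first by rewrite leqn0 => /eqP->.
  rewrite leq_eqVlt ltnS => /orP[/eqP->//|/IHn]/subset_trans; apply.
  by have [] := fP (y n).
have /choice[r rP] n : exists r, ann N (sval (y n.+1)) r /\ ~ ann N (sval (y n)) r.
  by have [] := fP (y n).
have [n [c rE]] := noeR r; have [_ /(_ _)] := rP n; apply.
rewrite rE; have [a0 aD aM] := ann_ideal (sval (y n)) sN.
apply: (big_ind (ann N (sval (y n)))) => // i _; apply: aM.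
by apply: (ymono _ _ (ltn_ord i)); have [] := rP i.
Qed.

(** Given infinitely many, some p_n is a combination of earlier p_i, so the prime [ann N (p n)]
    contains the intersection of the earlier annihilators, hence one of them, and equals it by
    maximality. *)
Lemma finitely_many_max_ann N : noetherian M -> is_submod N ->
  exists2 xs : seq M, (forall x, x \in xs -> max_ann N x)
    & forall y, max_ann N y -> exists2 x, x \in xs & ann N y = ann N x.
Proof.
move=> noeM sN; apply: contrapT => /forall2NP noxs.
pose T := {xs : seq M | forall x, x \in xs -> max_ann N x}.
have step (xs : T) : exists y,
    max_ann N y /\ forall x, x \in sval xs -> ann N y <> ann N x.
  case: xs => xs /= xsP; have [//|/existsNP[y /not_implyP[yP]]] := noxs xs.
  by move=> /forall2NP yxs; exists y; split=> // x xxs; have [] := yxs x.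
have [f fP] := choice step.
have ext (xs : T) x : x \in f xs :: sval xs -> max_ann N x.
  by rewrite inE => /orP[/eqP->|/(svalP xs)//]; have [] := fP xs.
pose ext' xs : T := exist _ _ (ext xs).
have xs0 : T by exists [::] => x; rewrite in_nil.
pose p n := f (iter n ext' xs0).
have pmem i n : (i < n)%N -> p i \in sval (iter n ext' xs0).
  elim: n => // n IHn; rewrite ltnS leq_eqVlt inE => /orP[/eqP->|/IHn->].
    by rewrite eqxx.
  by rewrite orbT.
have pmax n : max_ann N (p n) by have [] := fP (iter n ext' xs0).
have [n [r pE]] := noeM p.
have [i ltin sub] : exists2 i, (i < n)%N & ann N (p i) `<=` ann N (p n).
  apply: (prime_ideal_meet (F := fun i => ann N (p i))).
  - exact: max_ann_prime.
  - by move=> i _; apply: ann_ideal.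
  move=> a ap; rewrite /ann /= pE scaler_sumr.
  apply: (submod_sum (F := fun i => a *: (r i *: p i))) => // i ltin.
  rewrite scalerA mulrC -scalerA; have [_ _ NM] := sN; apply: NM; exact: ap.
have [_ /(_ (p i) (pmem _ _ ltin))] := fP (iter n ext' xs0); apply.
by apply/seteqP; split=> //; apply: (pmax i).2 => //; have [] := pmax n.
Qed.

Definition reg a N : Prop := forall x, N (a *: x) -> N x.

(** The primes are the maximal annihilators: a zerodivisor on M/N kills some class, and so lies in
    one of them. *)
Lemma zerodivisors_primes N : noetherian R^o -> noetherian M -> is_submod N ->
  exists2 ps : seq (set R),
      forall p, p \in ps -> prime_set p /\ forall a, reg a N -> ~ p a
    & forall c, (forall p, p \in ps -> ~ p c) -> reg c N.
Proof.
move=> noeR noeM sN; have [xs xsP xsall] := finitely_many_max_ann noeM sN.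
exists [seq ann N x | x <- xs].
  move=> _ /mapP[x /xsP xmax ->]; split; first exact: max_ann_prime.
  by move=> a aN /aN; case: xmax.
move=> c cP x Ncx; apply: contrapT => /(max_ann_exists noeR sN)[y ymax].
move=> /(_ c Ncx) yc; have [z zxs yz] := xsall y ymax.
by apply: (cP (ann N z)); rewrite ?map_f// -yz.
Qed.

Definition addmul N a : set M := [set x | exists y z, N z /\ x = a *: y + z].

Lemma addmul_submod N a : is_submod N -> is_submod (addmul N a).
Proof.
move=> [N0 ND NM]; split.
- by exists 0, 0; rewrite scaler0 addr0.
- move=> _ _ [y [z [Nz ->]]] [y' [z' [Nz' ->]]].
  by exists (y + y'), (z + z'); rewrite scalerDr addrACA; split=> //; apply: ND.
- move=> b _ [y [z [Nz ->]]]; exists (b *: y), (b *: z).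
  by rewrite scalerDr !scalerA [b * a]mulrC; split=> //; apply: NM.
Qed.

Lemma addmulC N a b : addmul (addmul N a) b = addmul (addmul N b) a.
Proof.
suff sub c e : addmul (addmul N c) e `<=` addmul (addmul N e) c.
  by apply/seteqP; split; apply: sub.
move=> _ [y [_ [[z [t [Nt ->]]] ->]]]; exists z, (e *: y + t).
by split; [exists y, t | rewrite addrCA].
Qed.

(** Weak regularity on M/N: properness of N + (s)M is not included, and is recovered in
    [regular_lengthsP]. *)
Fixpoint wreg N s : Prop :=
  if s is a :: s' then reg a N /\ wreg (addmul N a) s' else True.

(* c is regular modulo N + (s_1, ..., s_j)M for every j < size s. *)
Fixpoint reg_along c N s : Prop :=
  if s is a :: s' then reg c N /\ reg_along c (addmul N a) s' else True.

(** The half of the exchange of a regular pair that holds over any ring: from ax = cy + z one gets y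
    = au + v with v in N, and then a(x - cu) lies in N. *)
Lemma reg_addmulC N a c : is_submod N -> reg a N -> reg c (addmul N a) ->
  reg a (addmul N c).
Proof.
move=> [N0 ND NM] aN cNa x [y [z [Nz axE]]].
have [u [v [Nv yE]]] : addmul N a y.
  apply: cNa; exists x, (- z); split; first by rewrite -scaleN1r; apply: NM.
  by rewrite axE addrK.
exists u, (x - c *: u); split; last by rewrite addrC subrK.
apply: aN.
rewrite scalerBr axE yE scalerDr !scalerA [a * c]mulrC addrAC.
by rewrite [_ + c *: v]addrC addrK; apply: ND => //; apply: NM.
Qed.

(** Exchange c with each entry of s in turn. The last entry a is lost, since c is not known to be
    regular modulo the whole sequence. *)
Lemma wreg_addmul N s a c : is_submod N -> wreg N (rcons s a) ->
  reg_along c N (rcons s a) -> wreg (addmul N c) s.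
Proof.
elim: s N => //= b s IHs N sN [bN wNs] [cN cNs]; split.
  apply: reg_addmulC => //; move: cNs.
  by case: s {IHs wNs} => [|? ?] /= [].
by rewrite addmulC; apply: IHs => //; apply: addmul_submod.
Qed.

(** Collect the primes of zerodivisors modulo each proper initial segment. The next entry of s lies
    in m and avoids them, so none of them contains m. *)
Lemma reg_along_primes m N s :
    noetherian R^o -> noetherian M -> is_submod N -> wreg N s ->
    (forall a, a \in s -> m a) ->
  exists2 ps : seq (set R), forall p, p \in ps -> prime_set p /\ ~ m `<=` p
    & forall c, (forall p, p \in ps -> ~ p c) -> reg_along c N s.
Proof.
move=> noeR noeM; elim: s N => [|a s IHs] N sN /=; first by exists [::].
move=> [aN wNs] sm; have [ps psP psr] := zerodivisors_primes noeR noeM sN.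
have [|qs qsP qsr] := IHs _ (addmul_submod a sN) wNs.
  by move=> b bs; apply: sm; rewrite inE bs orbT.
exists (ps ++ qs).
  move=> p; rewrite mem_cat => /orP[/psP[pP pr]|/qsP//]; split=> // mp.
  by apply: (pr a aN); apply/mp/sm; rewrite mem_head.
move=> c cP; split; [apply: psr|apply: qsr] => p pin;
  by apply: cP; rewrite mem_cat pin ?orbT.
Qed.

(* An element of A regular modulo every N + (s_1, ..., s_j)M, j < size s, can
   be moved to the front of s at the cost of the last entry of s. *)
Lemma wreg_change m A N s :
    noetherian R^o -> noetherian M ->
    (exists a, A a) -> (forall x y, A x -> A y -> A (x + y)) ->
    (forall x y, A x -> A y -> A (x * y)) ->
    (forall p, prime_set p -> A `<=` p -> m `<=` p) ->
    is_submod N -> wreg N s -> (forall a, a \in s -> m a) ->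
  exists s', [/\ size s' = size s, wreg N s' & forall a, a \in s' -> A a].
Proof.
move=> noeR noeM A0 AD AM mA.
elim/last_ind: s N => [|s a _] N; first by exists [::].
(* Induction on the length with N free: the recursive call concerns N + cM and a sequence with one
   entry less. *)
have [n le_n] := ubnP (size (rcons s a)).
elim: n => // n IHn in s a le_n N *.
move=> sN wN sm; have [ps psP psr] := reg_along_primes noeR noeM sN wN sm.
have [p /psP[pP mp]|c Ac cps] := prime_avoidance (ps := ps) AD AM A0.
  by split=> // /mA; apply: contra_not mp; apply.
move: {psr} (psr c cps) => cN; have wNc := wreg_addmul sN wN cN.
have Nc : reg c N by move: cN; case: s {sm wN le_n wNc} => [|? ?] /= [].
case/lastP: s => [|s b] in le_n sm wN cN wNc *.
  by exists [:: c]; split=> // b; rewrite inE => /eqP->.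
have [||s' [size_s' ws' s'A]] := IHn s b _ _ (addmul_submod c sN) wNc.
- by move: le_n; rewrite !size_rcons ltnS.
- by move=> x xs; apply: sm; rewrite mem_rcons inE xs orbT.
exists (c :: s'); split=> //=; first by rewrite size_s' !size_rcons.
by move=> x; rewrite inE => /orP[/eqP->|/s'A].
Qed.

End RegularSequences.

(** * Depth and retracts *)

Section SeqSmul.
Variables (R : comNzRingType) (M : lmodType R).
Implicit Types (N : set M) (s : seq R) (m : set R).

Lemma seq_smulP s (x : M) :
  seq_smul s x <-> exists y : nat -> M, x = \sum_(i < size s) s`_i *: y i.
Proof.
split=> [[y ->]|[y ->]]; last by exists (fun i => y i).
exists (fun n => if insub n is Some i then y i else 0).
by apply: eq_bigr => i _; rewrite valK.
Qed.

(** This puts (s)M in the form in which [wreg] accumulates it. *)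
Lemma seq_smulE s : seq_smul s = foldl (@addmul R M) [set 0] s.
Proof.
elim/last_ind: s => [|s a IHs].
  by apply/seteqP; split=> [_ /seq_smulP[y ->]|_ ->]; [|exists (fun=> 0)];
    rewrite big_ord0.
have rconsE (y : nat -> M) : \sum_(i < size (rcons s a)) (rcons s a)`_i *: y i =
    \sum_(i < size s) s`_i *: y i + a *: y (size s).
  rewrite size_rcons big_ord_recr /= nth_rcons ltnn eqxx; congr (_ + _).
  by apply: eq_bigr => i _; rewrite nth_rcons ltn_ord.
rewrite foldl_rcons -IHs; apply/seteqP; split=> [_ /seq_smulP[y ->]|].
  exists (y (size s)), (\sum_(i < size s) s`_i *: y i).
  by rewrite rconsE addrC; split=> //; apply/seq_smulP; exists y.
move=> _ [y [_ [/seq_smulP[z ->] ->]]]; apply/seq_smulP.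
pose u i := if i == size s then y else z i.
exists u; rewrite rconsE /u eqxx addrC; congr (_ + _); apply: eq_bigr => i _.
by rewrite ltn_eqF.
Qed.

Lemma wreg_take N s :
  (forall i, (i < size s)%N -> reg s`_i (foldl (@addmul R M) N (take i s)))
  <-> wreg N s.
Proof.
elim: s N => [|a s IHs] N //=; split=> [regs|[aN /IHs wNs] [|i] //].
  by split; [exact: (regs 0%N)|apply/IHs => i; exact: (regs i.+1)].
exact: wNs.
Qed.

Lemma regular_seqP s :
  regular_seq M s <-> wreg ([set 0] : set M) s /\ seq_smul s <> (setT : set M).
Proof.
rewrite -wreg_take; split=> -[regs sT]; split=> // i ltis x;
  [rewrite -seq_smulE|rewrite seq_smulE]; exact: regs.
Qed.

Lemma submod0 : is_submod ([set 0] : set M).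
Proof.
by split=> //= [_ _ -> ->|a _ ->]; rewrite ?addr0 ?scaler0.
Qed.

Lemma seq_smul_sub m s : (forall a, a \in s -> m a) ->
  seq_smul s `<=` (ideal_smul m : set M).
Proof. by move=> sm x sx; exists s. Qed.

(** Properness is automatic for a sequence in m, as (s)M lies in mM. *)
Lemma regular_lengthsP m : (ideal_smul m : set M) <> setT -> forall n,
  regular_lengths M m n <-> exists s, [/\ size s = n, wreg ([set 0] : set M) s
    & forall a, a \in s -> m a].
Proof.
move=> mT n; split=> [[s [/regular_seqP[ws _] sm] <-]|[s [<- ws sm]]].
  by exists s.
exists s => //; split=> //; apply/regular_seqP; split=> // sT; apply: mT.
by apply/seteqP; split=> // x _; apply: (seq_smul_sub sm); rewrite sT.
Qed.

Lemma depth_Fin m q : depth M m = Fin q ->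
  [/\ (ideal_smul m : set M) <> setT, regular_lengths M m q
    & forall l, regular_lengths M m l -> (l <= q)%N].
Proof.
rewrite /depth; case: pselect => // mT; case: pselect => // exq [<-].
by case: (cid exq) => n [].
Qed.

Lemma depth_le_Fin m q : (ideal_smul m : set M) <> setT ->
    (forall l, regular_lengths M m l -> (l <= q)%N) ->
  le_enat (depth M m) (Fin q).
Proof.
move=> mT bnd; rewrite /depth; case: pselect => // mT'.
case: pselect => [exq|[]]; first by case: (cid exq) => n [nM _] /=; apply: bnd.
(* The empty sequence gives a length, so a bounded set of lengths has a maximum and the default
   [Inf] does not occur. *)
have ex0 : exists n, `[< regular_lengths M m n >].
  by exists 0%N; apply/asboolP/(regular_lengthsP mT); exists [::].
have [|n /asboolP nM nmax] := @ex_maxnP _ q ex0; first by move=> l /asboolP/bnd.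
by exists n; split=> // l lM; apply/nmax/asboolP.
Qed.

End SeqSmul.

Section Retracts.
Variables (R : comNzRingType) (M P : lmodType R) (phi : {rmorphism R -> R}).
Variables (iota : P -> M) (rho : M -> P).
Hypothesis iotaL : forall b y z, iota (b *: y + z) = phi b *: iota y + iota z.
Hypothesis rhoL : forall b y z, rho (phi b *: y + z) = b *: rho y + rho z.
Hypothesis iotaK : cancel iota rho.

(** P is a direct summand of M restricted along phi. The maps [iota] and [rho] exchange Q + bP and N
    + phi(b)M, so their compatibility with the submodules persists along the sequence. *)
Lemma wreg_retract (N : set M) (Q : set P) bs :
    (forall x, Q x -> N (iota x)) -> (forall x, N x -> Q (rho x)) ->
    iota 0 = 0 -> rho 0 = 0 ->
  wreg N (map phi bs) -> wreg Q bs.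
Proof.
move=> QN NQ iota0 rho0; elim: bs N Q QN NQ => //= b bs IHbs N Q QN NQ [bN wNbs].
split; last first.
  apply: IHbs wNbs => _ [y [z [zin ->]]].
    by exists (iota y), (iota z); split; [exact: QN|exact: iotaL].
  by exists (rho y), (rho z); split; [exact: NQ|exact: rhoL].
move=> x Qbx; rewrite -(iotaK x); apply/NQ/bN.
by rewrite -[_ *: _]addr0 -iota0 -iotaL; apply: QN; rewrite addr0.
Qed.

(* Depth over the maximal ideal m can be tested on sequences in phi(m), and
   these are regular on P as soon as they are regular on M. *)
Lemma depth_retract (m : set R) :
    noetherian R^o -> noetherian M ->
    is_ideal m -> (forall p, prime_set p -> phi @` m `<=` p -> m `<=` p) ->
    (ideal_smul m = setT :> set M -> ideal_smul m = setT :> set P) ->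
  le_enat (depth M m) (depth P m).
Proof.
move=> noeR noeM [m0 mD mM] mphi MP.
have iota0 : iota 0 = 0.
  apply: (@addrI _ (iota 0)).
  by rewrite addr0; have := iotaL 1 0 0; rewrite rmorph1 !scale1r addr0.
have rho0 : rho 0 = 0 by rewrite -iota0 iotaK.
case PE: (depth P m) => [q|]; last by case: (depth M m).
have [PT _ qmax] := depth_Fin PE.
(* If mM = M then mP = P, and the depth of P would be infinite by convention. *)
have MT : (ideal_smul m : set M) <> setT by move=> /MP.
apply: depth_le_Fin => // l /(regular_lengthsP MT)[s [<- ws sm]]; apply: qmax.
have [|||s' [sz ws' s'm]] := wreg_change (A := phi @` m) noeR noeM _ _ _ mphi
  (submod0 M) ws sm.
- by exists 0, 0; rewrite // rmorph0.
- move=> _ _ [a ma <-] [b mb <-].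
  by exists (a + b); [exact: mD|exact: rmorphD].
- move=> _ _ [a ma <-] [b mb <-].
  by exists (a * b); [exact: mM|exact: rmorphM].
have [bs s'E bsm] : exists2 bs, s' = map phi bs & forall b, b \in bs -> m b.
  elim: s' s'm {sz ws'} => [|a s' IHs'] s'm; first by exists [::].
  have [b mb ba] := s'm a (mem_head _ _).
  have [|bs -> bsm] := IHs'; first by move=> c cs'; apply: s'm; rewrite inE cs' orbT.
  by exists (b :: bs); rewrite /= ?ba// => c; rewrite inE => /orP[/eqP->|/bsm].
apply/(regular_lengthsP PT); exists bs; split=> //.
  by rewrite -sz s'E size_map.
apply: (wreg_retract (N := [set 0]) _ _ iota0 rho0); last by rewrite -s'E.
  by move=> _ ->; exact: iota0.
by move=> _ ->; exact: rho0.
Qed.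

End Retracts.

(** * Polynomial rings are Noetherian *)

(** Repeatedly choose an index at which u attains its minimum over the remaining tail. *)
Lemma monotone_subsequence (u : nat -> nat) :
  exists2 f : nat -> nat, {homo f : i j / (i < j)%N}
    & {homo u \o f : i j / (i <= j)%N}.
Proof.
have /choice[g gP] N : exists n, (N <= n)%N /\ forall k, (N <= k)%N -> (u n <= u k)%N.
  have ex : exists x, `[< exists2 n, (N <= n)%N & u n = x >].
    by exists (u N); apply/asboolP; exists N.
  have [_ /asboolP[n leNn <-] xmin] := ex_minnP ex.
  by exists n; split=> // k leNk; apply: xmin; apply/asboolP; exists k.
pose f n := iter n (fun m => g m.+1) (g 0%N).
have f_lt n : (f n < f n.+1)%N by have [] := gP (f n).+1.
exists f; first exact: (homo_ltn ltn_trans).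
apply: (homo_leq leqnn leq_trans) => n /=.
have [N leN fmin] : exists2 N, (N <= f n)%N &
    forall k, (N <= k)%N -> (u (f n) <= u k)%N.
  case: n => [|n]; first by have [] := gP 0%N; exists 0%N.
  by have [] := gP (f n).+1; exists (f n).+1.
by apply/fmin/(leq_trans leN)/ltnW.
Qed.

(** Pass to a subsequence nondecreasing in one coordinate after another; its first two terms are
    then comparable. *)
Lemma dickson d (a : nat -> 'X_{1..d}) :
  exists i j, (i < j)%N /\ (a i <= a j)%MM.
Proof.
suff /(_ d (leqnn d))[f f_lt fa] n : (n <= d)%N ->
    exists2 f : nat -> nat, {homo f : i j / (i < j)%N}
    & forall c : 'I_d, (c < n)%N -> {homo (fun n => a (f n) c) : i j / (i <= j)%N}.
  exists (f 0%N), (f 1%N); split; first exact: f_lt.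
  by apply/mnm_lepP => c; apply: fa.
elim: n => [|n IHn] ltnd; first by exists id.
have [f f_lt fa] := IHn (ltnW ltnd).
have [g g_lt ga] := monotone_subsequence (fun k => a (f k) (Ordinal ltnd)).
exists (f \o g); first by move=> i j /g_lt/f_lt.
move=> c; rewrite ltnS leq_eqVlt => /orP[/eqP cn|/fa fac] i j leij.
  by rewrite (_ : c = Ordinal ltnd); [exact: ga|exact: val_inj].
by apply: fac; apply: (homo_leq leqnn leq_trans) leij => k; apply/ltnW/g_lt.
Qed.

(** If no p_n lies in the ideal of its predecessors, choose q_n in the ideal of p_0, ..., p_n but
    not in that of the predecessors, with least leading monomial. By [dickson] some lead of q_i
    divides that of q_j with i < j, and cancelling it contradicts the choice of q_j. *)
Lemma mpoly_noetherian (k : fieldType) d : noetherian {mpoly k[d]}^o.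
Proof.
move=> p; apply: contrapT => nspan.
pose span n : set {mpoly k[d]} :=
  [set x | exists r : nat -> {mpoly k[d]}, x = \sum_(i < n) r i * p i].
have spanD n x y : span n x -> span n y -> span n (x + y).
  move=> [r ->] [r' ->]; exists (fun i => r i + r' i).
  by rewrite -big_split; apply: eq_bigr => i _; rewrite mulrDl.
have spanM n b x : span n x -> span n (b * x).
  move=> [r ->]; exists (fun i => b * r i).
  by rewrite mulr_sumr; apply: eq_bigr => i _; rewrite mulrA.
have spanS n x : span n x -> span n.+1 x.
  move=> [r ->]; exists (fun i => if (i < n)%N then r i else 0).
  rewrite big_ord_recr /= ltnn mul0r addr0.
  by apply: eq_bigr => i _; rewrite ltn_ord.
have spanW i n x : (i <= n)%N -> span i x -> span n x.
  elim: n => [|n IHn]; first by rewrite leqn0 => /eqP->.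
  by rewrite leq_eqVlt => /orP[/eqP->//|/IHn H] /H/spanS.
pose T n := [set x | span n.+1 x /\ ~ span n x].
have /choice[q qP] n : exists q, T n q /\ forall y, T n y -> ~ (mlead y < mlead q)%O.
  have Tp : T n (p n).
    split; last by move=> [r rE]; apply: nspan; exists n, r.
    exists (fun i => (i == n)%:R); rewrite big_ord_recr /= eqxx mul1r big1 ?add0r//.
    by move=> i _; rewrite ltn_eqF ?mul0r.
  elim/mleadrect: (p n) Tp => x IHx Tx.
  have [[y Ty ltyx]|/forall2NP nlt] := pselect (exists2 y, T n y & (mlead y < mlead x)%O).
    exact: IHx ltyx Ty.
  by exists x; split=> // y Ty; have [] := nlt y.
have [i [j [ltij leij]]] := dickson (fun n => mlead (q n)).
have [[qjS qj] qjmin] := qP j; have [[qiS qi] _] := qP i.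
have span0 n : span n 0 by exists (fun=> 0); rewrite big1// => ? _; rewrite mul0r.
have q0 n : q n != 0 by apply/eqP => qn0; have [[_]] := qP n; rewrite qn0; case.
pose m := (mlead (q j) - mlead (q i))%MM.
pose c := mleadc (q j) / mleadc (q i).
pose b : {mpoly k[d]} := c *: 'X_[m].
have c0 : c != 0 by rewrite mulf_neq0 ?invr_eq0 ?mleadc_eq0.
have bq0 : b * q i != 0.
  by rewrite mulf_neq0// scaler_eq0 negb_or c0 -msupp_eq0 msuppX.
have bqi n : (i < n)%N -> span n (b * q i) by move=> ltin; apply/spanM/(spanW i.+1).
(* As i < j, the multiple of q_i lies in [span j], so subtracting it does not leave [T j]. *)
have Ty : T j (q j - b * q i).
  split; first by apply: spanD => //; rewrite -mulN1r; apply/spanM/bqi/ltnW.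
  by move=> yj; apply: qj; rewrite -[q j](subrK (b * q i)); apply: spanD => //; exact: bqi.
apply: (qjmin _ Ty).
have leadE : mlead (b * q i) = mlead (q j).
  rewrite mleadM ?q0//; last by move: bq0; rewrite mulf_eq0 negb_or => /andP[].
  by rewrite mleadZ// mleadXm /m submK.
have y0 : q j - b * q i != 0.
  by apply/eqP => y0; case: Ty => _; rewrite y0; case.
rewrite lt_neqAle; apply/andP; split; last first.
  by apply: le_trans (mleadB_le _ _) _; rewrite leadE joinxx.
apply: contraNneq y0 => yj; rewrite -mleadc_eq0 yj mcoeffB -{2}leadE.
rewrite mleadM ?q0//; last by move: bq0; rewrite mulf_eq0 negb_or => /andP[].
rewrite mleadcM mleadZ// mleadcZ mleadXm mcoeffX eqxx mulr1 /c divfK ?subrr//.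
by rewrite mleadc_eq0.
Qed.

(** * Ideals and quotients as modules *)

Lemma ideal_mod_noetherian (R : comNzRingType) (I : ideal R) :
  noetherian R^o -> noetherian (ideal_mod I).
Proof.
move=> noeR p; have [n [r rE]] := noeR (fun n => val (p n)).
exists n, r; apply: val_inj; rewrite rE raddf_sum.
exact: eq_bigr.
Qed.

Section QuotientModule.
Local Open Scope quotient_scope.
Variables (R : comNzRingType) (I : ideal R).

Definition quot_pi (x : R) : quot_mod I := \pi_(quot_mod I) (x : R^o).

Lemma quot_piP (x y : R) : quot_pi x = quot_pi y <-> ideal_set I (x - y).
Proof.
split=> [/eqP|Ixy]; first by rewrite -Quotient.idealrBE => /asboolP.
by apply/eqP; rewrite -Quotient.idealrBE; apply/asboolP.
Qed.

Lemma quot_pi_lin (a x y : R) : quot_pi (a * x + y) = a *: quot_pi x + quot_pi y.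
Proof. by rewrite /quot_pi quot_mod_piD; congr (_ + _); rewrite -quot_mod_scale_pi. Qed.

Lemma quot_pi_repr (x : quot_mod I) : quot_pi (repr x) = x.
Proof. exact: reprK. Qed.

Lemma quot_pi_sum n (r : nat -> R) (x : nat -> R) :
  quot_pi (\sum_(i < n) r i * x i) = \sum_(i < n) r i *: quot_pi (x i).
Proof.
elim: n => [|n IHn]; last by rewrite !big_ord_recr /= addrC quot_pi_lin IHn addrC.
rewrite !big_ord0; apply: (@addrI _ (quot_pi 0)); rewrite addr0.
by have := quot_pi_lin 1 0 0; rewrite mul1r scale1r addr0.
Qed.

Lemma quot_mod_noetherian : noetherian R^o -> noetherian (quot_mod I).
Proof.
move=> noeR p; have [n [r rE]] := noeR (fun n => repr (p n)).
exists n, r; rewrite -[LHS]quot_pi_repr rE.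
apply: etrans (quot_pi_sum n r (fun i => repr (p i))) _.
by apply: eq_bigr => i _; rewrite quot_pi_repr.
Qed.

End QuotientModule.

(** * The substitution of m-th powers *)

Section PowerSubstitution.
Variables (k : fieldType) (d m : nat).
Local Notation R := {mpoly k[d]}.

Definition pow_subst (f : R) : R := f \mPo [tuple 'X_i ^+ m | i < d].

HB.instance Definition _ :=
  GRing.RMorphism.copy pow_subst (comp_mpoly [tuple 'X_i ^+ m | i < d]).

Lemma pow_substX a : pow_subst 'X_[a] = 'X_[a *+ m].
Proof.
rewrite /pow_subst comp_mpolyX [RHS]mpolyXE_id; apply: eq_bigr => i _.
by rewrite tnth_mktuple -exprM mulmnE mulnC.
Qed.

Lemma pow_substE f : pow_subst f = \sum_(a <- msupp f) f@_a *: 'X_[a *+ m].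
Proof.
rewrite {1}[f]mpolyE rmorph_sum; apply: eq_bigr => a _.
by rewrite -pow_substX; apply: comp_mpolyZ.
Qed.

(* The left inverse of pow_subst that kills the monomials outside its image. *)
Definition pow_root (f : R) : R :=
  \sum_(a : 'X_{1..d < msize f}) f@_(a *+ m) *: 'X_[a].

Hypothesis m_gt0 : (0 < m)%N.

(** The bound [msize f] on the sum loses nothing: for m > 0 the degree of [a *+ m] is at least that
    of a. *)
Lemma mcoeff_pow_root f a : (pow_root f)@_a = f@_(a *+ m).
Proof.
have [lt|ge] := ltnP (mdeg a) (msize f).
  exact: (mcoeff_mpoly (fun a => f@_(a *+ m))).
rewrite [RHS]memN_msupp_eq0.
  rewrite raddf_sum big1 //= => b _; rewrite mcoeffZ mcoeffX.
  have [ba|_] := eqVneq; last by rewrite mulr0.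
  by have := bmdeg b; rewrite ba ltnNge ge.
apply/negP => /msize_mdeg_lt; rewrite mdegMn ltnNge => /negP; apply.
by apply: leq_trans ge _; rewrite leq_pmulr.
Qed.

Lemma mcoeffXM (a u : 'X_{1..d}) (g : R) :
  ('X_[a] * g)@_u = if (a <= u)%MM then g@_(u - a) else 0.
Proof.
rewrite mulrC; case: ifP => [le_au|nle].
  by rewrite -{1}(submK le_au) addmC mcoeffMX.
apply: memN_msupp_eq0; apply: contraFN nle.
by rewrite (perm_mem (msuppMX _ _)) => /mapP[v _ ->]; rewrite lem_addr.
Qed.

(** Multiplication by a monomial of the image shifts exponents by a multiple of m, so it preserves
    which monomials are m-th powers. *)
Lemma pow_rootL b f g :
  pow_root (pow_subst b * f + g) = b * pow_root f + pow_root g.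
Proof.
apply/mpolyP => u; rewrite mcoeff_pow_root !mcoeffD mcoeff_pow_root; congr (_ + _).
have -> : b * pow_root f = \sum_(a <- msupp b) b@_a *: 'X_[a] * pow_root f.
  by rewrite -mulr_suml -mpolyE.
rewrite pow_substE mulr_suml !raddf_sum /=; apply: eq_bigr => a _.
rewrite -!scalerAl !mcoeffZ !mcoeffXM mcoeff_pow_root; congr (_ * _).
have -> : (a *+ m <= u *+ m)%MM = (a <= u)%MM.
  apply/mnm_lepP/mnm_lepP => le i; have := le i; rewrite !mulmnE.
    by rewrite leq_pmul2r.
  by rewrite leq_pmul2r.
by congr (if _ then _@_ _ else _); apply/mnmP => i; rewrite mnmBE !mulmnE mnmBE mulnBl.
Qed.

Lemma pow_substK : cancel pow_subst pow_root.
Proof.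
have root0 : pow_root 0 = 0.
  by apply/mpolyP => u; rewrite mcoeff_pow_root !mcoeff0.
move=> f; have := pow_rootL f 1 0; rewrite mulr1 !addr0 => ->.
rewrite root0 addr0 -[RHS]mulr1; congr (_ * _); apply/mpolyP => u.
rewrite mcoeff_pow_root !mcoeff1; congr (_%:R); congr nat_of_bool.
apply/eqP/eqP => [/mnmP um|->]; apply/mnmP => i; last by rewrite mulmnE mnm0E.
by have := um i; rewrite mulmnE !mnm0E => /eqP;
  rewrite muln_eq0 (gtn_eqF m_gt0) orbF => /eqP.
Qed.

End PowerSubstitution.

(** * Filtrations by weights *)

Section GeneratedIdeals.
Variable R : comNzRingType.
Implicit Types (I J : ideal R) (S p : set R).

Lemma ideal_gen_sub S : S `<=` ideal_gen S.
Proof. by move=> x Sx J [_]; apply. Qed.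

Lemma ideal_gen_min S p : is_ideal p -> S `<=` p -> ideal_gen S `<=` p.
Proof. by move=> pI Sp x; apply. Qed.

Lemma ideal_sum I n (F : nat -> R) :
  (forall i, (i < n)%N -> ideal_set I (F i)) -> ideal_set I (\sum_(i < n) F i).
Proof.
have [I0 ID _] := idealP I => IF.
by apply: (big_ind (ideal_set I)) => // i _; apply: IF.
Qed.

Lemma prime_expr p x n : prime_set p -> p (x ^+ n) -> p x.
Proof.
move=> [_ p1 pM]; elim: n => [|n IHn]; first by rewrite expr0.
by rewrite exprS => /pM[|/IHn].
Qed.

Lemma ideal_inj I J : ideal_set I = ideal_set J -> I = J.
Proof.
case: I J => [I IP] [J JP] /= IJ; rewrite -IJ in JP *.
by congr Ideal; exact: Prop_irrelevance.
Qed.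

End GeneratedIdeals.

Section WeightedDegree.
Variable d : nat.
Implicit Types (w : 'I_d -> nat) (a b : 'X_{1..d}).

Definition wdeg w a : nat := \sum_(i < d) w i * a i.

Lemma wdegD w a b : wdeg w (a + b)%MM = (wdeg w a + wdeg w b)%N.
Proof. by rewrite -big_split; apply: eq_bigr => i _; rewrite mnmDE mulnDr. Qed.

Lemma wdegMn w a m : wdeg w (a *+ m)%MM = (wdeg w a * m)%N.
Proof. by rewrite big_distrl; apply: eq_bigr => i _; rewrite mulmnE mulnA. Qed.

Lemma wdeg0 w : wdeg w 0%MM = 0%N.
Proof. by rewrite /wdeg big1// => i _; rewrite mnm0E muln0. Qed.

Lemma wdeg1 a : wdeg (fun=> 1%N) a = mdeg a.
Proof. by rewrite mdegE; apply: eq_bigr => i _; rewrite mul1n. Qed.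

End WeightedDegree.

Section WeightedIdeals.
Variables (k : fieldType) (d : nat).
Local Notation R := {mpoly k[d]}.
Implicit Types (W : set ('I_d -> nat)) (f g : R).

Definition wideal_set W (n : nat) : set R :=
  [set f | forall a, a \in msupp f -> forall w, W w -> (n <= wdeg w a)%N].

Lemma wideal_setM W i j f g :
  wideal_set W i f -> wideal_set W j g -> wideal_set W (i + j) (f * g).
Proof.
move=> If Ig a /msuppM_le /allpairsP[[b c] /= [bf cg ->]] w Ww.
by rewrite wdegD leq_add ?If ?Ig.
Qed.

Lemma wideal_is_ideal W n : is_ideal (wideal_set W n).
Proof.
split; first by move=> a; rewrite msupp0.
- by move=> f g If Ig a /msuppD_le; rewrite mem_cat => /orP[/If|/Ig].
- by move=> f g Ig; rewrite -[n]add0n; apply: wideal_setM.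
Qed.

Definition wideal W n : ideal R := Ideal (wideal_is_ideal W n).

Lemma wideal_X W n a : (forall w, W w -> (n <= wdeg w a)%N) ->
  wideal_set W n 'X_[a].
Proof. by move=> na b; rewrite msuppX inE => /eqP->. Qed.

Lemma max_ideal_wideal : max_ideal k d `<=` wideal_set [set (fun=> 1%N)] 1.
Proof.
apply: ideal_gen_min; first exact: wideal_is_ideal.
by move=> _ [i _ <-]; apply: wideal_X => w ->; rewrite wdeg1 mdeg1.
Qed.

(** Graded Nakayama: I = mI forces all terms of elements of I to have degree at least j, for every
    j. *)
Lemma max_ideal_smul_eq0 (I : ideal R) :
  ideal_smul (max_ideal k d) = setT :> set (ideal_mod I) ->
  forall f, ideal_set I f -> f = 0.
Proof.
move=> mI; have sub j : I `<=` wideal_set [set (fun=> 1%N)] j.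
  elim: j => [|j IHj] f If; first by move=> a _ w _.
  have fI : f \in ideal_pred I by apply/asboolP.
  have : [set: ideal_mod I] (IdealMod fI) by [].
  rewrite -mI => -[s [sm [y /(congr1 val)]]].
  rewrite raddf_sum => /= ->; have [w0 wD _] := wideal_is_ideal [set (fun=> 1%N)] j.+1.
  apply: (big_ind (wideal_set _ _)) => // i _; rewrite -[j.+1]add1n.
  apply: (wideal_setM (f := s`_i) (g := val (y i))).
    by apply: max_ideal_wideal; apply: sm; apply: mem_nth.
  by apply/IHj/asboolP; exact: (valP (y i)).
move=> f /sub fj; apply/eqP; apply: contraT => /mlead_supp fl.
by have := fj (mdeg (mlead f)).+1 _ fl _ erefl; rewrite wdeg1 ltnn.
Qed.

(** The class of 1 is then that of some g without constant term, and 1 - g lies in I. *)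
Lemma max_ideal_quot_smulT (I : ideal R) :
  ideal_smul (max_ideal k d) = setT :> set (quot_mod I) ->
  exists2 f, ideal_set I f & 0%MM \in msupp f.
Proof.
move=> mI; have : [set: quot_mod I] (quot_pi I 1) by [].
rewrite -mI => -[s [sm /seq_smulP[y yE]]].
pose g := \sum_(i < size s) s`_i * repr (y i).
have g0 : g@_0%MM = 0.
  apply: memN_msupp_eq0; apply/negP => g0.
  suff /(_ _ g0 _ erefl) : wideal_set [set (fun=> 1%N)] 1 g by rewrite wdeg0.
  apply: (ideal_sum (I := wideal [set (fun=> 1%N)] 1)
    (F := fun i => s`_i * repr (y i))) => i lti.
  have [_ _ wM] := wideal_is_ideal [set (fun=> 1%N)] 1.
  by rewrite mulrC; apply: wM; apply: max_ideal_wideal; apply: sm; apply: mem_nth.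
exists (1 - g); last by rewrite mcoeff_msupp mcoeffB mcoeff1 eqxx g0 subr0 oner_eq0.
apply/quot_piP; rewrite yE /g (quot_pi_sum I (size s) (nth 0 s) (fun i => repr (y i))).
by apply: eq_bigr => i _; rewrite quot_pi_repr.
Qed.

Lemma ceil_divP n m x : (0 < m)%N -> (n <= x * m)%N = (ceil_div n m <= x)%N.
Proof.
by case: m => // m _; rewrite -[RHS]ltnS ltn_divLR// mulSn /= -addnS addnC leq_add2l.
Qed.

Section RootsOfMonomials.
Variables (W : set ('I_d -> nat)) (n m : nat).
Hypotheses (n_gt0 : (0 < n)%N) (m_gt0 : (0 < m)%N).
Local Notation c := (ceil_div n m).

Lemma wideal_pow_subst f : wideal_set W c f -> wideal_set W n (pow_subst m f).
Proof.
move=> cf; rewrite pow_substE big_seq; have [w0 wD wM] := wideal_is_ideal W n.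
apply: (big_ind (wideal_set W n)) => // a af; rewrite -mul_mpolyC.
apply/wM/wideal_X => w Ww; rewrite wdegMn ceil_divP//; exact: cf.
Qed.

Lemma wideal_pow_root f : wideal_set W n f -> wideal_set W c (pow_root m f).
Proof.
move=> nf a; rewrite mcoeff_msupp mcoeff_pow_root// -mcoeff_msupp => /nf na w /na.
by rewrite wdegMn ceil_divP.
Qed.

(** The image contains every x_i^m, and a prime containing x_i^m contains x_i. *)
Lemma pow_subst_prime (p : set R) : prime_set p ->
  pow_subst m @` max_ideal k d `<=` p -> max_ideal k d `<=` p.
Proof.
move=> pP mp; apply: ideal_gen_min; first by case: pP.
move=> _ [i _ <-]; apply: (prime_expr (n := m) pP); rewrite mpolyXn -pow_substX.
by apply: mp; exists 'X_i => //; apply: ideal_gen_sub; exists i.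
Qed.

Lemma depth_ideal_wideal :
  le_enat (depth_ideal (wideal W n)) (depth_ideal (wideal W c)).
Proof.
have iP (x : ideal_mod (wideal W c)) : pow_subst m (val x) \in ideal_pred (wideal W n).
  by apply/asboolP/wideal_pow_subst/asboolP; exact: (valP x).
have rP (x : ideal_mod (wideal W n)) : pow_root m (val x) \in ideal_pred (wideal W c).
  by apply/asboolP/wideal_pow_root/asboolP; exact: (valP x).
apply: (depth_retract (phi := pow_subst m)
    (iota := fun x => IdealMod (iP x)) (rho := fun x => IdealMod (rP x))).
- by move=> b y z; apply: val_inj; rewrite /= rmorphD rmorphM.
- by move=> b y z; apply: val_inj; rewrite /= pow_rootL.
- by move=> x; apply: val_inj; rewrite /= pow_substK.
- exact: mpoly_noetherian.
- exact/ideal_mod_noetherian/mpoly_noetherian.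
- exact: idealP.
- exact: pow_subst_prime.
(* If mF_n = F_n then F_n = 0, so F_c, which embeds in it, is 0 as well and mF_c = F_c. *)
move=> /max_ideal_smul_eq0 n0; apply/seteqP; split=> // x _; exists [::]; split=> //.
exists (fun=> 0); rewrite big_ord0; apply: val_inj => /=.
rewrite -(pow_substK m_gt0 (val x)) [pow_subst m _]n0.
  by apply/mpolyP => u; rewrite mcoeff_pow_root// !mcoeff0.
exact/asboolP/iP.
Qed.

Lemma depth_quot_wideal :
  le_enat (depth_quot (wideal W n)) (depth_quot (wideal W c)).
Proof.
(* Both maps are defined on chosen representatives; [iotaE] and [rhoE] give independence of the
   choice. *)
pose iota x := quot_pi (wideal W n) (pow_subst m (repr (x : quot_mod (wideal W c)))).
pose rho x := quot_pi (wideal W c) (pow_root m (repr (x : quot_mod (wideal W n)))).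
have pow_substL b f g :
    pow_subst m (b * f + g) = pow_subst m b * pow_subst m f + pow_subst m g.
  by rewrite rmorphD rmorphM.
have pow_rootB f g : pow_root m (f - g) = pow_root m f - pow_root m g.
  by apply/mpolyP => u; rewrite mcoeffB !mcoeff_pow_root// mcoeffB.
have iotaE f : iota (quot_pi _ f) = quot_pi _ (pow_subst m f).
  apply/quot_piP; rewrite -rmorphB; apply: wideal_pow_subst.
  by apply: (quot_piP (wideal W c) _ _).1; rewrite quot_pi_repr.
have rhoE f : rho (quot_pi _ f) = quot_pi _ (pow_root m f).
  apply/quot_piP; rewrite -pow_rootB; apply: wideal_pow_root.
  by apply: (quot_piP (wideal W n) _ _).1; rewrite quot_pi_repr.
apply: (depth_retract (phi := pow_subst m) (iota := iota) (rho := rho)).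
- move=> b y z; rewrite -[y]quot_pi_repr -[z]quot_pi_repr -quot_pi_lin !iotaE.
  by rewrite pow_substL quot_pi_lin.
- move=> b y z; rewrite -[y]quot_pi_repr -[z]quot_pi_repr -quot_pi_lin !rhoE.
  by rewrite pow_rootL// quot_pi_lin.
- by move=> x; rewrite -[x]quot_pi_repr iotaE rhoE pow_substK.
- exact: mpoly_noetherian.
- exact/quot_mod_noetherian/mpoly_noetherian.
- exact: idealP.
- exact: pow_subst_prime.
(* A nonzero constant term in F_n with n > 0 forces W to be empty; then F_c = R and the quotient is
   0. *)
move=> /max_ideal_quot_smulT[f If f0]; have W0 w : ~ W w.
  by move=> Ww; have := If _ f0 _ Ww; rewrite wdeg0 leqNgt n_gt0.
apply/seteqP; split=> // x _; exists [::]; split=> //.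
exists (fun=> 0); rewrite big_ord0 -[LHS]quot_pi_repr -(quot_pi_repr 0).
by apply/quot_piP => a _ w /W0.
Qed.

End RootsOfMonomials.

(** * From the inequality for ceilings to the limit of depths *)

Lemma enat_min (F : nat -> enat) : exists2 n, (0 < n)%N
  & forall j, (0 < j)%N -> le_enat (F n) (F j).
Proof.
have [[x xF]|noFin] := pselect (exists x, exists2 n, (0 < n)%N & F n = Fin x).
  have ex : exists x, `[< exists2 n, (0 < n)%N & F n = Fin x >].
    by exists x; exact/asboolP.
  have [y /asboolP[n n_gt0 Fn] ymin] := ex_minnP ex.
  exists n => // j j_gt0; rewrite Fn; case Fj: (F j) => [z|//] /=.
  by apply: ymin; apply/asboolP; exists j.
exists 1%N => // j j_gt0; case Fj: (F j) => [z|]; last by case: (F 1%N).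
by case: noFin; exists z, j.
Qed.

(** Take m = ceil(n/n0). Then m >= n0, so m(n0 - 1) <= (m - 1)n0 < n <= m n0. *)
Lemma ceil_div_onto n0 n : (0 < n0)%N -> (n0 * n0 <= n)%N ->
  exists2 m, (0 < m)%N & ceil_div n m = n0.
Proof.
move=> n0_gt0 len; pose m := ceil_div n n0.
have lem : (n <= m * n0)%N by rewrite ceil_divP.
have gem : (m.-1 * n0 < n)%N.
  rewrite ltnNge ceil_divP// -ltnNge -/m prednK//.
  rewrite lt0n; apply: contraTneq lem => ->; rewrite mul0n -ltnNge.
  by apply: leq_trans len; rewrite muln_gt0 n0_gt0.
have m_ge : (n0 <= m)%N.
  by rewrite -(leq_pmul2r n0_gt0); apply: leq_trans len lem.
have m_gt0 : (0 < m)%N by exact: leq_trans m_ge.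
exists m => //; apply/eqP; rewrite eqn_leq -ceil_divP// mulnC lem /=.
rewrite leqNgt -[n0 in (_ < n0)%N](prednK n0_gt0) ltnS -ceil_divP// -ltnNge.
apply: leq_ltn_trans gem; move: m_gt0 n0_gt0 m_ge; case: (m) (n0) => [|a] [|b] //= _ _.
by rewrite ltnS !mulnS [(b * a)%N]mulnC leq_add2r.
Qed.

Lemma le_enat_anti a b : le_enat a b -> le_enat b a -> a = b.
Proof.
case: a b => [p|] [q|] //= pq qp; congr Fin; apply/eqP.
by rewrite eqn_leq pq qp.
Qed.

Lemma wideal_filtration W :
  depth_ceil_le (wideal W) /\ depth_lim_eq_min (wideal W).
Proof.
split=> [n m n_gt0 m_gt0|]; first exact: depth_ideal_wideal.
have [n0 n0_gt0 n0min] := enat_min (fun n => depth_quot (wideal W n)).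
exists (depth_quot (wideal W n0)); split=> //; last by exists n0.
exists (n0 * n0)%N => n len.
have n_gt0 : (0 < n)%N by apply: leq_trans len; rewrite muln_gt0 n0_gt0.
have [m m_gt0 mE] := ceil_div_onto n0_gt0 len.
by apply: le_enat_anti (n0min n n_gt0); rewrite -mE; exact: depth_quot_wideal.
Qed.

End WeightedIdeals.

(** * Initial forms *)

Section InitialForms.
Variables (k : fieldType) (d : nat) (w : 'I_d -> nat).
Local Notation R := {mpoly k[d]}.
Local Notation wid := (wideal_set (k := k) [set w]).
Implicit Types f g : R.

Lemma initial_form i f : wid i f -> (exists2 a, a \in msupp f & wdeg w a = i) ->
  exists f0 f1, [/\ f = f0 + f1, f0 != 0,
    forall a, a \in msupp f0 -> wdeg w a = i & wid i.+1 f1].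
Proof.
move=> If [a0 a0f a0i]; pose P a := wdeg w a == i.
pose part (Q : pred 'X_{1..d}) : R := \sum_(a <- filter Q (msupp f)) f@_a *: 'X_[a].
have partE Q : msupp (part Q) =i filter Q (msupp f).
  apply: perm_mem; apply: msupp_sumX; first by rewrite filter_uniq// msupp_uniq.
  by move=> a; rewrite mem_filter -mcoeff_msupp => /andP[].
exists (part P), (part (predC P)); split.
- by rewrite /part !big_filter -(bigID P predT) -mpolyE.
- apply/eqP => part0; have := partE P a0.
  by rewrite part0 msupp0 mem_filter a0f /P a0i eqxx.
- by move=> a; rewrite partE mem_filter => /andP[/eqP].
- move=> a; rewrite partE mem_filter => /andP[/= ai af] _ ->.
  by rewrite ltn_neqAle eq_sym ai; exact: If.
Qed.

(** The product of the initial forms is nonzero in the domain R and has weight i + j; all other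
    contributions have larger weight and cannot cancel it. *)
Lemma wdeg_mul i j f g : wid i f -> wid j g ->
    (exists2 a, a \in msupp f & wdeg w a = i) ->
    (exists2 b, b \in msupp g & wdeg w b = j) ->
  exists2 c, c \in msupp (f * g) & wdeg w c = (i + j)%N.
Proof.
move=> If Ig fi gj.
have [f0 [f1 [fE f0_neq0 f0i If1]]] := initial_form If fi.
have [g0 [g1 [gE g0_neq0 g0j Ig1]]] := initial_form Ig gj.
have c_supp := mlead_supp (mulf_neq0 f0_neq0 g0_neq0).
set c := mlead _ in c_supp.
have cij : wdeg w c = (i + j)%N.
  have /allpairsP[[a b] /= [af bg ->]] := msuppM_le c_supp.
  by rewrite wdegD f0i// g0j.
exists c => //; rewrite mcoeff_msupp.
have -> : f * g = f0 * g0 + (f0 * g1 + f1 * g).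
  by rewrite addrA -mulrDr -gE -mulrDl -fE.
have [_ ID _] := wideal_is_ideal k [set w] (i + j).+1.
have rest : wid (i + j).+1 (f0 * g1 + f1 * g).
  apply: ID; last by rewrite -addSn; apply: wideal_setM.
  by rewrite -addnS; apply: wideal_setM => // a /f0i <- _ ->.
rewrite mcoeffD [X in _ + X]memN_msupp_eq0 ?addr0 -?mcoeff_msupp//.
by apply/negP => /rest/(_ w erefl); rewrite cij ltnn.
Qed.

Lemma wdeg_min f : f != 0 ->
  exists2 i, wid i f & exists2 a, a \in msupp f & wdeg w a = i.
Proof.
move=> f0; have ex : exists i, `[< exists2 a, a \in msupp f & wdeg w a = i >].
  by exists (wdeg w (mlead f)); apply/asboolP; exists (mlead f) => //; exact: mlead_supp.
have [i /asboolP[a af ai] imin] := ex_minnP ex.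
exists i; last by exists a.
by move=> b bf _ ->; apply: imin; apply/asboolP; exists b.
Qed.

(** Such an s has order 0, so sf has the order of f. This serves both for primality of [face_prime]
    and for clearing the denominators of symbolic powers. *)
Lemma wideal_cancel n s f : (exists2 a, a \in msupp s & wdeg w a = 0%N) ->
  wid n (s * f) -> wid n f.
Proof.
move=> s0 Isf; have [->|f_neq0] := eqVneq f 0; first by move=> a; rewrite msupp0.
have [i If fi] := wdeg_min f_neq0.
have [|c csf ci] := wdeg_mul (i := 0) (f := s) _ If s0 fi; first by move=> a _ w' _.
have ni : (n <= i)%N by rewrite -[i]ci; exact: Isf.
by move=> a af _ ->; apply: leq_trans ni _; apply: If.
Qed.

Lemma wdeg_exp i f n : wid i f -> (exists2 a, a \in msupp f & wdeg w a = i) ->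
  wid (n * i) (f ^+ n) /\ exists2 a, a \in msupp (f ^+ n) & wdeg w a = (n * i)%N.
Proof.
move=> If fi; elim: n => [|n [IHn IHn']]; last first.
  by rewrite exprS mulSn; split; [exact: wideal_setM|exact: wdeg_mul].
rewrite expr0 mul0n; split; first by move=> a _ w' _.
by exists 0%MM; rewrite ?wdeg0// msupp1 inE.
Qed.

End InitialForms.

(** * Symbolic powers *)

Section IdealPowers.
Variable R : comNzRingType.
Implicit Types I : ideal R.

(** The z with xz in I^(n+1) form an ideal containing the generators of I^n. *)
Lemma ideal_powS I n x y :
  ideal_set I x -> ideal_set (ideal_pow I n) y -> ideal_set (ideal_pow I n.+1) (x * y).
Proof.
move=> Ix; pose p : set R := [set z | ideal_set (ideal_pow I n.+1) (x * z)].
have [P0 PD PM] := idealP (ideal_pow I n.+1).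
apply: (ideal_gen_min (p := p)).
  split; rewrite /p /=; first by rewrite mulr0.
    by move=> u v pu pv; rewrite mulrDr; apply: PD.
  by move=> a u pu; rewrite mulrCA; apply: PM.
move=> _ [g gI <-]; apply: ideal_gen_sub.
exists (fun i => if unlift ord0 i is Some j then g j else x).
  by move=> i; case: unliftP.
rewrite big_ord_recl unlift_none; congr (_ * _).
by apply: eq_bigr => i _; rewrite liftK.
Qed.

Lemma ideal_pow0 I x : ideal_set (ideal_pow I 0) x.
Proof.
have [_ _ PM] := idealP (ideal_pow I 0); rewrite -[x]mulr1; apply: PM.
by apply: ideal_gen_sub; exists (fun=> 0); [case|rewrite big_ord0].
Qed.

End IdealPowers.

Section MonomialIdeals.
Variables (k : fieldType) (d : nat).
Local Notation R := {mpoly k[d]}.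
Implicit Types (W : set ('I_d -> nat)) (I J : ideal R) (f : R).

Lemma wideal_ideal_pow W c J n : ideal_set J `<=` wideal_set W c ->
  ideal_set (ideal_pow J n) `<=` wideal_set W (n * c).
Proof.
move=> JW; apply: ideal_gen_min; first exact: wideal_is_ideal.
move=> _ [g gJ <-]; elim: n g gJ => [|n IHn] g gJ; first by move=> a _ w _.
by rewrite big_ord_recl mulSn; apply: wideal_setM; [exact/JW/gJ|exact: IHn].
Qed.

Lemma monomial_sum_mem I f :
  (forall a, a \in msupp f -> ideal_set I 'X_[a]) -> ideal_set I f.
Proof.
move=> fI; have [I0 ID IM] := idealP I; rewrite [f]mpolyE big_seq.
apply: (big_ind (ideal_set I)) => // a af.
by rewrite -mul_mpolyC; apply/IM/fI.
Qed.

Lemma monomial_dvd_mem I a b : (a <= b)%MM -> ideal_set I 'X_[a] -> ideal_set I 'X_[b].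
Proof.
by move=> le_ab Ia; have [_ _ IM] := idealP I; rewrite -(submK le_ab) mpolyXD; apply: IM.
Qed.

Lemma prime_monomial (p : set R) a : prime_set p -> p 'X_[a] ->
  exists2 i, (0 < a i)%N & p 'X_i.
Proof.
move=> pP pa; apply: contrapT => /forall2NP np; have [_ p1 pM] := pP.
suff : ~ p 'X_[a] by [].
rewrite mpolyXE_id; apply: (big_ind (fun x => ~ p x)) => [//|x y px py /pM[]//|i _].
have [a0|npi] := np i; last exact: contra_not (prime_expr pP) npi.
by move: a0; case: (a i) => [|n] // _; rewrite expr0.
Qed.

End MonomialIdeals.

Section SymbolicPowers.
Variables (k : fieldType) (d : nat) (A : set 'X_{1..d}) (I : ideal {mpoly k[d]}).
Hypothesis A_sqfree : forall a i, A a -> (a i <= 1)%N.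
Hypothesis IE : ideal_set I = ideal_gen [set ('X_[a] : {mpoly k[d]}) | a in A].
Local Notation R := {mpoly k[d]}.
Implicit Types (S T : {set 'I_d}) (p q : ideal R).

(** Vertex covers of the hypergraph of supports of the generators; the minimal ones correspond to
    the minimal primes of I. *)
Definition vcover S : Prop := forall a, A a -> exists2 i, i \in S & (0 < a i)%N.

Definition min_vcover S : Prop :=
  vcover S /\ forall T, vcover T -> T \subset S -> S \subset T.

Definition indicator S : 'I_d -> nat := fun i => i \in S.

(** The prime generated by the variables of S, encoded by weights so that membership is read off the
    exponents. *)
Definition face_prime S : ideal R := wideal k [set indicator S] 1.

Definition vars_in p : {set 'I_d} := [set i | `[< ideal_set p 'X_i >]].

Lemma wdeg_indicator_gt0 S a : (0 < wdeg (indicator S) a)%N ->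
  exists2 i, i \in S & (0 < a i)%N.
Proof.
move=> a0; apply: contrapT => /forall2NP nS; move: a0; rewrite /wdeg big1// => i _.
rewrite /indicator; have [//|] := nS i; first by move=> /negP/negbTE->.
by move=> /negP; rewrite -eqn0Ngt => /eqP->; rewrite muln0.
Qed.

Lemma wdeg_indicator_ge S (a : 'X_{1..d}) i : i \in S -> (a i <= wdeg (indicator S) a)%N.
Proof. by move=> iS; rewrite /wdeg (bigD1 i)//= /indicator iS mul1n leq_addr. Qed.

Lemma notin_face_prime S f : ~ ideal_set (face_prime S) f ->
  exists2 a, a \in msupp f & wdeg (indicator S) a = 0%N.
Proof.
move=> /existsNP[a /not_implyP[af /existsNP[_ /not_implyP[-> a0]]]].
by exists a => //; apply/eqP; rewrite -leqn0 leqNgt; apply/negP.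
Qed.

Lemma face_prime_prime S : prime_ideal (face_prime S).
Proof.
split; first by move=> /(_ 0%MM); rewrite msupp1 inE eqxx => /(_ erefl _ erefl); rewrite wdeg0.
move=> x y xy; have [|/notin_face_prime x0] := pselect (ideal_set (face_prime S) x).
  by left.
by right; apply: wideal_cancel xy.
Qed.

Lemma gen_face_prime S : vcover S -> ideal_set I `<=` face_prime S.
Proof.
move=> covS; rewrite IE; apply: ideal_gen_min; first exact: wideal_is_ideal.
move=> _ [a Aa <-]; apply: wideal_X => _ ->; have [i iS ai] := covS a Aa.
exact: leq_trans (wdeg_indicator_ge _ iS).
Qed.

Lemma prime_ideal_set p : prime_ideal p -> prime_set p.
Proof. by move=> [p1 pM]; split=> //; exact: idealP. Qed.

Lemma vars_in_vcover p : prime_ideal p -> ideal_set I `<=` p -> vcover (vars_in p).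
Proof.
move=> /prime_ideal_set pP Ip a Aa.
have [|i ai pi] := prime_monomial (a := a) pP.
  by apply: Ip; rewrite IE; apply: ideal_gen_sub; exists a.
by exists i => //; rewrite inE; apply/asboolP.
Qed.

Lemma face_prime_sub S p : (forall i, i \in S -> ideal_set p 'X_i) ->
  ideal_set (face_prime S) `<=` p.
Proof.
move=> Sp f Sf; apply: monomial_sum_mem => a /Sf/(_ _ erefl)/wdeg_indicator_gt0.
move=> [i iS ai]; apply: monomial_dvd_mem (Sp i iS); apply/mnm_lepP => j.
by rewrite mnm1E; case: eqP => // <-.
Qed.

Lemma face_primeX S i : ideal_set (face_prime S) 'X_i -> i \in S.
Proof.
move=> /(_ U_(i)%MM); rewrite msuppX inE eqxx => /(_ erefl _ erefl).
move=> /wdeg_indicator_gt0[j jS]; rewrite mnm1E.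
by case: eqP => // ->.
Qed.

(** The variables in a prime between I and [face_prime S] form a cover inside S, hence all of S. *)
Lemma face_prime_minimal S : min_vcover S -> minimal_prime I (face_prime S).
Proof.
move=> [covS minS]; split; [exact: face_prime_prime|exact: gen_face_prime|].
move=> q qP Iq qS; apply: face_prime_sub => i iS.
have /fintype.subsetP/(_ i iS) : S \subset vars_in q.
  apply: minS; first exact: vars_in_vcover.
  by apply/fintype.subsetP => j; rewrite inE => /asboolP/qS/face_primeX.
by rewrite inE => /asboolP.
Qed.

(** For a cover T among the variables of p, the prime [face_prime T] lies between I and p, so p is
    contained in it. *)
Lemma minimal_prime_face p : minimal_prime I p ->
  min_vcover (vars_in p) /\ ideal_set p `<=` face_prime (vars_in p).
Proof.
move=> [pP Ip pmin]; have covp := vars_in_vcover pP Ip.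
have psub T : vcover T -> T \subset vars_in p -> ideal_set p `<=` face_prime T.
  move=> covT /fintype.subsetP Tp; apply: pmin; [exact: face_prime_prime|exact: gen_face_prime|].
  by apply: face_prime_sub => i /Tp; rewrite inE => /asboolP.
split; last exact: psub.
split=> // T covT Tp; apply/fintype.subsetP => i; rewrite inE => /asboolP pi.
exact/face_primeX/(psub T covT Tp).
Qed.

(* Minimality of S gives, for each i in S, a generator involving i and no other
   variable of S, so x_i is in I up to the product of the variables outside S. *)
Lemma min_vcover_mem S n a : min_vcover S -> (n <= wdeg (indicator S) a)%N ->
  ideal_set (ideal_pow I n) 'X_[[multinom (i \notin S : nat) | i < d] *+ n + a].
Proof.
move=> [covS minS]; set b := [multinom _ | i < d]%MM.
have xiI i : i \in S -> ideal_set I 'X_[b + U_(i)].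
  move=> iS; have ncov : ~ vcover (S :\ i).
    by move=> /minS; rewrite subD1set => /(_ erefl)/fintype.subsetP/(_ i iS); rewrite !inE eqxx.
  have /existsNP[g /not_implyP[Ag /forall2NP gS]] := ncov.
  apply: (monomial_dvd_mem (a := g)); last first.
    by rewrite IE; apply: ideal_gen_sub; exists g.
  apply/mnm_lepP => j; rewrite mnmDE mnmE mnm1E.
  have [_|neq_ij] := eqVneq i j.
    by apply: leq_trans (A_sqfree j Ag) _; rewrite addn1.
  have [jS|jS] := boolP (j \in S); last by rewrite addn0; apply: A_sqfree.
  have [nj|/negP] := gS j; first by case: nj; rewrite !inE eq_sym neq_ij.
  by rewrite -eqn0Ngt => /eqP->.
(* Each factor from I uses up one copy of b and one variable of S dividing the monomial of a. *)
elim: n a => [|n IHn] a na; first exact: ideal_pow0.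
have [i iS ai] := wdeg_indicator_gt0 (leq_ltn_trans (leq0n n) na).
have le_ia : (U_(i) <= a)%MM.
  by apply/mnm_lepP => j; rewrite mnm1E; case: eqP => // <-.
have -> : (b *+ n.+1 + a = (b + U_(i)) + (b *+ n + (a - U_(i))))%MM.
  rewrite mulmS -{1}(submK le_ia); apply/mnmP => j.
  by rewrite !mnmDE [X in (_ + X = _)%N]addnC addnACA.
rewrite mpolyXD; apply: ideal_powS; first exact: xiI.
apply: IHn; move: na; rewrite -{1}(submK le_ia) wdegD.
have -> : wdeg (indicator S) U_(i) = 1%N.
  rewrite /wdeg (bigD1 i)//= /indicator iS mnm1E eqxx big1// => j ji.
  by rewrite mnm1E eq_sym (negbTE ji) muln0.
by rewrite addn1.
Qed.

Lemma symbolic_power_wideal n : symbolic_power I n =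
  wideal k [set indicator S | S in [set S | min_vcover S]] n.
Proof.
apply/ideal_inj/seteqP; split=> [f If a af _ [S minS <-]|f Wf p pmin].
  have [s sS sf] := If _ (face_prime_minimal minS).
  (* The multiplier s lies outside the prime of S, so it has a term of weight 0 and can be
     cancelled. *)
  suff : wideal_set [set indicator S] n f by move=> /(_ a af _ erefl).
  apply: wideal_cancel (notin_face_prime sS) _.
  rewrite -[n]muln1; apply: wideal_ideal_pow sf; exact: gen_face_prime minS.1.
have [minS psub] := minimal_prime_face pmin.
set S := vars_in p in minS psub.
(* The n-th power of the product of the variables outside S: it has weight 0, so it is not in p. *)
exists 'X_[[multinom (i \notin S : nat) | i < d] *+ n].
  move=> /psub/(_ _ _ _ erefl); rewrite msuppX => /(_ _ (mem_head _ _)).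
  rewrite wdegMn /wdeg big1 ?mul0n// => i _; rewrite mnmE /indicator.
  by case: (i \in S).
apply: monomial_sum_mem => c; rewrite mulrC (perm_mem (msuppMX _ _)).
move=> /mapP[a af ->]; apply: min_vcover_mem => //.
by apply: (Wf a af); exists S.
Qed.

End SymbolicPowers.

(** * Monomial valuations and rational powers *)

Section Valuations.
Variables (k : fieldType) (d : nat) (K : realType).
Local Notation R := {mpoly k[d]}.
Implicit Types (v : valuation R K) (w : 'I_d -> nat) (f : R).

Definition has_weight v w : Prop := forall a, v 'X_[a] = ((wdeg w a)%:R)%:E.

Lemma val_idealE r (nu : 'I_r -> valuation R K) n :
    (forall i, monomial_valuation (nu i)) -> (forall i, normalized (nu i)) ->
  val_ideal nu n = wideal k [set w | exists i, has_weight (nu i) w] n.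
Proof.
move=> nu_mon nu_norm; apply/ideal_inj/seteqP; split=> f nf.
  move=> a af w [i iw]; rewrite -(ler_nat K) -lee_fin -iw.
  apply: le_trans (nf i) _; rewrite nu_mon.
  exact: ge_bigmin_seq.
move=> i; have [w iw] := nu_norm i; rewrite nu_mon big_seq.
apply: (big_ind (fun x => n%:R%:E <= x)%E); first exact: leey.
  by move=> x y nx ny; rewrite le_min nx.
move=> a af; rewrite iw lee_fin ler_nat; apply: nf => //.
by exists i.
Qed.

Lemma valuation1 v : v 1 = 0%E.
Proof.
have [_ /(_ 1 (oner_neq0 _))[x _ vx] vM _] := valuationP v.
have := vM 1 1; rewrite mulr1 vx -EFinD => -[/eqP].
by rewrite -subr_eq0 opprD addNKr oppr_eq0 => /eqP->.
Qed.

(** By multiplicativity the values on the variables determine those on monomials, whether or not v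
    is monomial. *)
Lemma integer_valued_weight v : integer_valued v -> exists w, has_weight v w.
Proof.
move=> vint; have X0 i : ('X_i : R) != 0 by rewrite -msupp_eq0 msuppX.
have /choice[w wE] i := vint _ (X0 i).
exists w => a; rewrite mpolyXE_id /wdeg.
have [_ _ vM _] := valuationP v.
apply: (big_ind2 (fun (x : R) (n : nat) => v x = n%:R%:E)).
- exact: valuation1.
- by move=> x m y n vx vy; rewrite vM vx vy natrD.
move=> i _; elim: (a i) => [|m IHm]; first by rewrite expr0 muln0 valuation1.
by rewrite exprS vM wE IHm mulnS natrD.
Qed.

Lemma weight_le_valuation v w n f :
  has_weight v w -> wideal_set [set w] n f -> (n%:R%:E <= v f)%E.
Proof.
move=> vw nf; pose I := val_ideal (fun _ : 'I_1 => v) n.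
suff /(_ ord0) : ideal_set I f by [].
apply: monomial_sum_mem => a af i; rewrite vw lee_fin ler_nat; exact: nf.
Qed.

(* The least weight j of a monomial of f is attained by f^n, whereas it is
   exceeded in every other term of the equation if j < N. *)
Lemma integral_wideal w N n (a : nat -> R) f :
    (forall i, (1 <= i <= n)%N -> wideal_set [set w] (i * N) (a i)) ->
    f ^+ n + \sum_(1 <= i < n.+1) a i * f ^+ (n - i) = 0 ->
  wideal_set [set w] N f.
Proof.
move=> aN fint; have [->|f0] := eqVneq f 0; first by move=> b; rewrite msupp0.
have [j fj fj'] := wdeg_min w f0.
have [leNj|ltjN] := leqP N j.
  by move=> b bf _ ->; apply: leq_trans leNj _; apply: fj.
have [c cf cw] := (wdeg_exp n fj fj').2.
have rest : wideal_set [set w] (n * j).+1 (\sum_(1 <= i < n.+1) a i * f ^+ (n - i)).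
  have [w0 wD _] := wideal_is_ideal k [set w] (n * j).+1.
  rewrite big_nat; apply: (big_ind (wideal_set _ _)) => // i.
  rewrite ltnS => /andP[i_gt0 le_in] b bin _ ->.
  have := wideal_setM (aN i _) (wdeg_exp (n - i) fj fj').1 bin erefl.
  rewrite i_gt0 le_in => /(_ isT); apply: leq_trans.
  rewrite -{1}(subnK le_in) mulnDl addnC -addSn leq_add2r.
  by rewrite ltn_pmul2l.
have := rest c; move: fint => /eqP; rewrite addrC addr_eq0 => /eqP->.
rewrite (perm_mem (msuppN _)) => /(_ cf w erefl).
by rewrite cw ltnn.
Qed.

Section RationalPowers.
Variables (J : ideal R) (r : nat) (v : 'I_r -> valuation R K) (c : 'I_r -> nat).
Hypotheses (J_mon : monomial_ideal J) (J_rees : rees_valuations J v c).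
Local Notation e := (\big[lcmn/1%N]_(i < r) c i).

(* The monomial weights of the valuations (e / c_i) v_i. *)
Definition rees_weights : set ('I_d -> nat) :=
  [set w | exists i w', has_weight (v i) w' /\ w = fun j => (e %/ c i * w' j)%N].

(** If c_i = 0, the i-th condition always holds and could be dropped, against minimality of the Rees
    valuations. *)
Lemma rees_value_gt0 i : (0 < c i)%N.
Proof.
have [_ _ det min] := J_rees; rewrite lt0n; apply/negP => /eqP ci0.
apply: (min [set~ i]%SET).
  by rewrite properT; apply/eqP => /setP/(_ i); rewrite !inE eqxx.
move=> n f; split=> [/det vf j _|vf]; first by apply: vf; rewrite inE.
apply/det => j _; have [->|ji] := eqVneq j i.
  by rewrite ci0 muln0 valuation_ge0.
by apply: vf; rewrite !inE.
Qed.

Lemma rees_weight_ideal i w :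
  has_weight (v i) w -> ideal_set J `<=` wideal_set [set w] (c i).
Proof.
move=> vw; have [_ vc _ _] := J_rees; have [_ Jc] := vc i.
have [A JE] := J_mon; move: Jc; rewrite JE => Jc.
apply: ideal_gen_min; first exact: wideal_is_ideal.
move=> _ [a Aa <-]; apply: wideal_X => _ ->.
rewrite -(ler_nat K) -lee_fin -vw; apply: Jc.
by apply: ideal_gen_sub; exists a.
Qed.

(** An integral equation bounds the monomial weights of f^e from below; conversely these weights
    bound the Rees valuations from below, and those detect integral closure. *)
Lemma rational_powerE n : rational_power J n e = wideal_set rees_weights n.
Proof.
have [vint vc det _] := J_rees.
have ce i : (c i %| e)%N by rewrite (bigD1 i)//= dvdn_lcml.
have wdegZ w q a : wdeg (fun j => (q * w j)%N) a = (q * wdeg w a)%N.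
  by rewrite big_distrr; apply: eq_bigr => j _; rewrite /= mulnA.
(* Clears the denominator c_i, which is positive and divides e. *)
have scale i w a : (n <= e %/ c i * wdeg w a)%N = (n * c i <= wdeg w a * e)%N.
  by rewrite -(leq_pmul2r (rees_value_gt0 i)) mulnAC divnK// [(e * _)%N]mulnC.
apply/seteqP; split=> f.
  move=> [N [b [N_gt0 bJ fint]]] a af _ [i [w [vw ->]]].
  rewrite wdegZ scale.
  have f0 : f != 0 by apply: contraTneq af => ->; rewrite msupp0.
  have [j fj fj'] := wdeg_min w f0.
  (* f^e attains the weight ej, where j is the least weight in f; hence ej >= n c_i, and every term
     of f has weight at least j. *)
  have [x xf xj] := (wdeg_exp e fj fj').2.
  have /(_ x xf w erefl) : wideal_set [set w] (n * c i) (f ^+ e).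
    apply: integral_wideal fint => m /bJ.
    exact/wideal_ideal_pow/wideal_ideal_pow/rees_weight_ideal.
  by rewrite xj => /leq_trans; apply; rewrite mulnC leq_mul2r fj ?orbT.
move=> Wf; apply/det => i _; have [w vw] := integer_valued_weight (vint i).
apply: (weight_le_valuation vw); have [->|f0] := eqVneq f 0.
  (* Needed because 0^0 = 1. *)
  have e_gt0 : (0 < e)%N.
    apply: (big_ind (fun x => 0 < x)%N) => // [x y x0 y0|j _].
      by rewrite lcmn_gt0 x0.
    exact: rees_value_gt0.
  by rewrite expr0n gtn_eqF// => a; rewrite msupp0.
have [j fj [a af aj]] := wdeg_min w f0.
have [fe _] := wdeg_exp e fj (ex_intro2 _ _ a af aj).
move=> x xf _ ->; apply: leq_trans (fe x xf w erefl).
rewrite -aj [(e * _)%N]mulnC -scale -wdegZ; apply: (Wf a af); exists i, w; split=> //.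
Qed.

End RationalPowers.

End Valuations.

Theorem theorem5p27 (k : fieldType) (d : nat) (K : realType) :
  [/\ forall (r : nat) (nu : 'I_r -> valuation {mpoly k[d]} K),
        (forall i, monomial_valuation (nu i)) ->
        (forall i, normalized (nu i)) ->
        depth_ceil_le (val_ideal nu) /\ depth_lim_eq_min (val_ideal nu),
      forall I : ideal {mpoly k[d]},
        squarefree_monomial_ideal I ->
        depth_ceil_le (symbolic_power I) /\ depth_lim_eq_min (symbolic_power I)
    & forall (J : ideal {mpoly k[d]}) (r : nat)
             (v : 'I_r -> valuation {mpoly k[d]} K) (c : 'I_r -> nat) (e : nat),
        monomial_ideal J ->
        (exists2 f, ideal_set J f & f <> 0%R) ->
        ~ ideal_set J 1%R ->
        rees_valuations J v c ->
        e = \big[lcmn/1%N]_(i < r) c i ->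
        exists F : nat -> ideal {mpoly k[d]},
          (forall n, ideal_set (F n) = rational_power J n e) /\
          depth_ceil_le F /\ depth_lim_eq_min F].
Proof.
split.
- move=> r nu nu_mon nu_norm.
  by rewrite (funext (fun n => val_idealE n nu_mon nu_norm)); exact: wideal_filtration.
- move=> I [A A_sqfree IE].
  by rewrite (funext (symbolic_power_wideal A_sqfree IE)); exact: wideal_filtration.
- move=> J r v c e J_mon _ _ J_rees ->.
  exists (wideal k (rees_weights v c)); split=> [n|].
    by rewrite (rational_powerE J_mon J_rees).
  exact: wideal_filtration.
Qed.
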